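(* For positive integers $n$, let $\mathfrak{D}_n^{\pm}$ and $(\mathfrak{B}_n\setminus\mathfrak{D}_n)^{\pm}$ denote the sets of $\pi\in\mathfrak{D}_n$ (resp. $\pi\in\mathfrak{B}_n\setminus\mathfrak{D}_n$) with $\mathrm{inv}_D(\pi)$ even ($+$) or odd ($-$), and define $$\mathrm{BDes}^{D,\pm}_n(t)=\sum_{\pi\in\mathfrak{D}_n^{\pm}}t^{\mathrm{des}_B(\pi)},\qquad \mathrm{BDes}^{B-D,\pm}_n(t)=\sum_{\pi\in(\mathfrak{B}_n\setminus\mathfrak{D}_n)^{\pm}}t^{\mathrm{des}_B(\pi)}.$$ Then the distributions of the coefficients of $\mathrm{BDes}^{D,\pm}_n(t)$ and of $\mathrm{BDes}^{B-D,\pm}_n(t)$ are asymptotically normal as $n\to\infty$. Over $\mathfrak{D}_n^{\pm}$ (uniform distribution), the random variable $\mathrm{des}_B$ has mean $n/2$ when $n\ge 3$ and variance $(n+1)/12$ when $n\ge 4$; over $(\mathfrak{B}_n\setminus\mathfrak{D}_n)^{\pm}$, the random variable $\mathrm{des}_B$ has mean $n/2$ when $n\ge 3$ and variance $(n+1)/12$ when $n\ge 4$.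
   Context: $\mathfrak{B}_n$ is the group of signed permutations of $\{\pm1,\dots,\pm n\}$, written $\pi=\pi_1\cdots\pi_n$ with $\pi_i=\pi(i)$. $\mathrm{negs}(\pi)=|\{i:\pi_i<0\}|$; $\mathfrak{D}_n=\{\pi\in\mathfrak{B}_n:\mathrm{negs}(\pi)\text{ even}\}$. $\mathrm{inv}_D(\pi)=|\{1\le i<j\le n:\pi_i>\pi_j\}|+|\{1\le i<j\le n:-\pi_i>\pi_j\}|$. With $\pi_0=0$, $\mathrm{des}_B(\pi)=|\{i\in\{0,\dots,n-1\}:\pi_i>\pi_{i+1}\}|$. To a polynomial $P(t)=\sum_k p_kt^k$ with nonnegative coefficients and $P(1)>0$ associate the random variable $X$ with $\Pr(X=k)=p_k/P(1)$; a sequence $P_n$ has asymptotically normal coefficient distribution if, with $\mu_n,\sigma_n^2$ the mean and variance of $X_n$, $\lim_{n\to\infty}\sup_{x\in\mathbb{R}}\left|\sum_{k\le\lfloor x\sigma_n+\mu_n\rfloor}\frac{p_{n,k}}{P_n(1)}-\Phi(x)\right|=0$, $\Phi$ being the standard normal cumulative distribution function. *)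

(* Defs.v *)
From HB Require Import structures.
From mathcomp Require Import all_boot all_order all_algebra all_fingroup.

Set Implicit Arguments.
Unset Strict Implicit.
Unset Printing Implicit Defensive.

Import Order.TTheory GRing.Theory Num.Theory.
Local Open Scope ring_scope.

(* {+-1, ..., +-n}: (i, false) stands for i + 1 and (i, true) for -(i + 1). *)
Notation letter n := ('I_n * bool)%type.

Definition letter_opp (n : nat) (x : letter n) : letter n := (x.1, ~~ x.2).

Definition letter_val (n : nat) (x : letter n) : int :=
  if x.2 then - (x.1.+1)%:Z else (x.1.+1)%:Z.

Definition signed_perms (n : nat) : {set {perm letter n}} :=
  [set p : {perm letter n} | [forall x, p (letter_opp x) == letter_opp (p x)]].

(* pi_(i + 1), the index i : 'I_n being 0-based. *)
Definition window (n : nat) (p : {perm letter n}) (i : 'I_n) : int :=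
  letter_val (p (i, false)).

(* The same word with pi_0 = 0 in front: here the index k is that of pi_k. *)
Definition window0 (n : nat) (p : {perm letter n}) (k : 'I_n.+1) : int :=
  if unlift ord0 k is Some i then window p i else 0.

Definition negs (n : nat) (p : {perm letter n}) : nat :=
  #|[set i : 'I_n | window p i < 0]|.

Definition invD (n : nat) (p : {perm letter n}) : nat :=
  (#|[set ij : 'I_n * 'I_n | (ij.1 < ij.2) && (window p ij.1 > window p ij.2)%R]|
   + #|[set ij : 'I_n * 'I_n |
         (ij.1 < ij.2) && (- window p ij.1 > window p ij.2)%R]|)%N.

Definition desB (n : nat) (p : {perm letter n}) : nat :=
  #|[set i : 'I_n |
      window0 p (widen_ord (leqnSn n) i) > window0 p (lift ord0 i)]|.

Definition even_signed_perms (n : nat) : {set {perm letter n}} :=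
  [set p in signed_perms n | ~~ odd (negs p)].

(* In the next two definitions s = false is the sign +, s = true the sign -. *)
Definition Dpm (n : nat) (s : bool) : {set {perm letter n}} :=
  [set p in even_signed_perms n | odd (invD p) == s].

Definition BDpm (n : nat) (s : bool) : {set {perm letter n}} :=
  [set p in signed_perms n :\: even_signed_perms n | odd (invD p) == s].

From mathcomp Require Import all_classical all_reals all_analysis.
Import numFieldNormedType.Exports.

Definition BDesD (R : realType) (s : bool) (n : nat) : {poly R} :=
  \sum_(p in Dpm n s) 'X^(desB p).

Definition BDesBD (R : realType) (s : bool) (n : nat) : {poly R} :=
  \sum_(p in BDpm n s) 'X^(desB p).

Definition unif_mean (R : realType) (T : finType) (A : {set T}) (f : T -> R) : R :=
  (\sum_(x in A) f x) / #|A|%:R.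

Definition unif_var (R : realType) (T : finType) (A : {set T}) (f : T -> R) : R :=
  unif_mean A (fun x => (f x - unif_mean A f) ^+ 2).

Definition coef_prob (R : realType) (P : {poly R}) (k : nat) : R := P`_k / P.[1].

Definition coef_mean (R : realType) (P : {poly R}) : R :=
  \sum_(k < size P) k%:R * coef_prob P k.

Definition coef_var (R : realType) (P : {poly R}) : R :=
  \sum_(k < size P) (k%:R - coef_mean P) ^+ 2 * coef_prob P k.

Definition coef_sd (R : realType) (P : {poly R}) : R := Num.sqrt (coef_var P).

Definition coef_cdf (R : realType) (P : {poly R}) (y : R) : R :=
  \sum_(k < size P | (k : nat)%:Z <= Num.floor y) coef_prob P k.

Definition Phi (R : realType) (x : R) : R :=
  fine (normal_prob (0 : R) 1 `]-oo, x]%classic).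

(* The supremum is taken in the extended reals, where it always exists. *)
Definition asymptotically_normal (R : realType) (P : nat -> {poly R}) : Prop :=
  (ereal_sup (range (fun x : R =>
     (`| coef_cdf (P n) (x * coef_sd (P n) + coef_mean (P n)) - Phi x |)%:E))
     @[n --> \oo] --> (0 : \bar R)%E)%classic.

(* Main.v *)
Require Import Defs.
From HB Require Import structures.
From mathcomp Require Import all_boot all_order all_algebra all_fingroup.
From mathcomp Require Import all_classical all_reals all_analysis.
From mathcomp Require Import ring lra zify.
Set Implicit Arguments.
Unset Strict Implicit.
Unset Printing Implicit Defensive.
Import Order.TTheory GRing.Theory Num.Theory.
Import numFieldNormedType.Exports.
Local Open Scope ring_scope.

(** The indicator of each of the four classes is a combination of the
    characters 1, (-1)^negs, (-1)^invD and their product. Inserting +-(n+1) in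
    the words of size n turns the sum of g (des_B) over B_(n+1) into
    - the sum over B_n of (2d+1) g(d) + (2n+1-2d) g(d+1) for the trivial
      character, d being the number of descents;
    - the sum of g(d) - g(d+1) for the two characters involving (-1)^negs, since
      the insertions of n+1 and -(n+1) in the same inner gap cancel;
    - for (-1)^invD, after two insertions, the sum of g(d) - 2 g(d+1) + g(d+2).
    Hence the three signed sums vanish on polynomials of small degree, which
    reduces the mean and the variance to those of des_B on B_n, and they are at
    most 2^n sup|g|, negligible before 2^n n!, which reduces asymptotic normality
    to that of des_B on B_n.

    On B_n, Y = des_B - n/2 is a Markov chain in n: from y it goes to y - 1/2 or
    y + 1/2 with probabilities 1/2 + y/(n+1) and 1/2 - y/(n+1). The function
    (a, v) |-> Phi(a / sqrt v) solves the heat equation, so along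
    a = c - (n/N) Y, with v decreasing by the variance of each step, its
    expectation is constant up to an error that sums to O(N^(-1/2)). Letting the
    final v be a small multiple of the variance of Y gives the uniform
    convergence of the distribution functions. *)

(** * Signed words and their statistics *)

Section Words.
Implicit Types (u v w : seq int) (x y c : int).

Definition insw w (j : nat) x := take j w ++ x :: drop j w.

(** The letter before the word is a parameter, so that the count splits over concatenations; des_B
    is the case [c = 0]. *)
Definition desw c w : nat := sumn (pairmap (fun x y => nat_of_bool (y < x)) c w).

Global Arguments insw : simpl never.
Global Arguments desw : simpl never.

Definition negsw w : nat := count (fun x => x < 0) w.

Fixpoint pairsw (r : rel int) w : nat :=
  if w is x :: s then (count (r x) s + pairsw r s)%N else 0%N.

Definition invw w : nat :=
  (pairsw (fun x y => y < x)%R w + pairsw (fun x y => y < - x)%R w)%N.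

Definition bounded (n : nat) w := all (fun x => (absz x <= n)%N) w.

Lemma desw_cat c u v : desw c (u ++ v) = (desw c u + desw (last c u) v)%N.
Proof. by rewrite /desw pairmap_cat sumn_cat. Qed.

Lemma desw_cons c x v : desw c (x :: v) = ((x < c)%R + desw x v)%N.
Proof. by []. Qed.

Lemma lt_big x c : (absz c < absz x)%N -> (x < c) = (x < 0).
Proof. by lia. Qed.

Lemma gt_big x c : (absz c < absz x)%N -> (c < x) = (0 < x).
Proof. by lia. Qed.

(** A letter dominating both neighbours makes exactly one descent, before it if it is negative and
    after it if it is positive. *)
Lemma desw_big c x y v : (absz c < absz x)%N -> (absz y < absz x)%N ->
  desw c [:: x, y & v] = (desw y v).+1.
Proof.
move=> cx yx; rewrite !desw_cons (lt_big cx) (gt_big yx).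
have : ((x < 0)%R + (0 < x)%R = 1)%N by case: (ltrgt0P x) yx => //; lia.
by lia.
Qed.

Lemma desw_same_sign c x x' v : (x < 0) = (x' < 0) ->
  (absz c < absz x)%N -> (absz c < absz x')%N ->
  all (fun y => (absz y < absz x)%N) v -> all (fun y => (absz y < absz x')%N) v ->
  desw c (x :: v) = desw c (x' :: v).
Proof.
move=> xx' cx cx'; case: v => [|y v] /=; first by rewrite !desw_cons (lt_big cx) (lt_big cx') xx'.
by case/andP=> yx _ /andP[yx' _]; rewrite !desw_big.
Qed.

Lemma bounded_take (n j : nat) w : bounded n w -> bounded n (take j w).
Proof. by move=> /allP bw; apply/allP => x /mem_take/bw. Qed.

Lemma bounded_last (n : nat) c u : (absz c <= n)%N -> bounded n u ->
  (absz (last c u) <= n)%N.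
Proof. by elim: u c => //= x u IH c _ /andP[xn /IH]; exact. Qed.

Lemma last_take w (j : nat) : (j <= size w)%N ->
  last 0 (take j w) = nth 0 (0%R :: w) j.
Proof.
by move=> jw; rewrite (last_nth 0) size_takel//; case: j jw => //= j jw; rewrite nth_take.
Qed.

(** In an inner gap the new letter makes one descent and destroys that of the gap, if any; at the
    end it makes one only if negative. *)
Lemma desw_insw (n : nat) w (j : nat) x : bounded n w -> (n < absz x)%N ->
  (j <= size w)%N -> desw 0 (insw w j x) =
  (desw 0 w + (if (j < size w)%N then ~~ (nth 0 w j < nth 0 (0%R :: w) j)%R else (x < 0)%R))%N.
Proof.
move=> bw nx jw; rewrite /insw desw_cat.
have bl : (absz (last 0%R (take j w)) < absz x)%N.
  by rewrite (leq_ltn_trans _ nx)// bounded_last// bounded_take.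
case: ltnP => jw'; last first.
  by rewrite drop_oversize// desw_cons (lt_big bl) take_oversize// addn0.
have E : drop j w = nth 0 w j :: drop j.+1 w by rewrite (drop_nth 0).
rewrite E desw_big//; last by rewrite (leq_ltn_trans _ nx)// (allP bw)// mem_nth.
have -> : desw 0 w = (desw 0 (take j w) + ((nth 0 w j < nth 0 (0%R :: w) j)%R
                      + desw (nth 0 w j)%R (drop j.+1 w)))%N.
  by rewrite -{1}(cat_take_drop j w) desw_cat E desw_cons last_take.
by case: (_ < _)%R => /=; lia.
Qed.

Lemma sum_desw w :
  (\sum_(j < size w) (nth 0%R w j < nth 0%R (0%R :: w) j)%R)%N = desw 0 w.
Proof.
rewrite /desw sumnE (big_nth 0%N) size_pairmap big_mkord.
by apply: eq_bigr => j _; rewrite (nth_pairmap 0).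
Qed.

Lemma negsw_insw w (j : nat) x : negsw (insw w j x) = ((x < 0)%R + negsw w)%N.
Proof.
by rewrite /negsw /insw count_cat /= -{3}(cat_take_drop j w) count_cat addnCA.
Qed.

Lemma pairsw_cat r u x v :
  pairsw r (u ++ x :: v) =
  (count (r^~ x) u + count (r x) v + pairsw r (u ++ v))%N.
Proof.
elim: u => //= y u IH; rewrite IH !count_cat /=; lia.
Qed.

(* x is counted once with each letter on its right, and 0 or 2 times with each
   letter on its left. *)
Lemma odd_invw_insw (n : nat) w (j : nat) x : bounded n w -> (n < absz x)%N ->
  (j <= size w)%N -> odd (invw (insw w j x)) = odd (size w - j) (+) odd (invw w).
Proof.
move=> bw nx jw; rewrite /invw /insw !pairsw_cat.
have bu : bounded n (take j w) by exact: bounded_take.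
have bv : bounded n (drop j w).
  by move: bw; rewrite -{1}(cat_take_drop j w) /bounded all_cat => /andP[].
have A : count (fun y => x < y)%R (take j w) = count (fun y => x < - y)%R (take j w).
  apply: eq_in_count => y /(allP bu) yn; lia.
have B : (count (fun y => y < x)%R (drop j w) + count (fun y => y < - x)%R (drop j w) =
          size w - j)%N.
  rewrite -size_drop.
  rewrite -(count_predC (fun y => y < x)%R (drop j w)); congr addn.
  by apply: eq_in_count => y /(allP bv) yn /=; lia.
rewrite A cat_take_drop -B; lia.
Qed.

(** * Enumeration of the signed words by insertion *)

Definition sgl (b : bool) (n : nat) : int := if b then - n%:Z else n%:Z.
Global Arguments sgl : simpl never.

Lemma sgl_lt0 b n : (sgl b n.+1 < 0) = b.
Proof. by case: b. Qed.

Lemma gt_sgl y b n : (absz y < n)%N -> (y < sgl b n) = ~~ b.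
Proof. by case: b; rewrite /sgl /=; lia. Qed.

Lemma lt_sgl y b n : (absz y < n)%N -> (sgl b n < y) = b.
Proof. by case: b; rewrite /sgl /=; lia. Qed.

Definition signed_gaps (n : nat) : seq (nat * bool) :=
  [seq (j, b) | j <- iota 0 n, b <- [:: false; true]].
Global Arguments signed_gaps : simpl never.

(** Built by inserting the largest letter, so that sums unfold along n; [swordsP] recognizes the
    words of signed permutations. *)
Fixpoint swords (n : nat) : seq (seq int) :=
  if n is m.+1 then
    [seq insw w jb.1 (sgl jb.2 n) | w <- swords m, jb <- signed_gaps n]
  else [:: [::]].

Lemma big_swords (V : nmodType) (F : seq int -> V) n :
  \sum_(w <- swords n.+1) F w = \sum_(w <- swords n) \sum_(j < n.+1)
     (F (insw w j (sgl false n.+1)) + F (insw w j (sgl true n.+1))).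
Proof.
rewrite -[swords n.+1]/[seq insw w jb.1 (sgl jb.2 n.+1) |
  w <- swords n, jb <- signed_gaps n.+1].
rewrite big_allpairs_dep; apply: eq_bigr => w _.
rewrite /signed_gaps big_allpairs -(big_mkord xpredT (fun j =>
  F (insw w j (sgl false n.+1)) + F (insw w j (sgl true n.+1)))).
by rewrite /index_iota subn0; apply: eq_bigr => j _; rewrite unlock /= addr0.
Qed.

Lemma absz_sgl b n : absz (sgl b n) = n.
Proof. by case: b; rewrite /sgl ?abszN. Qed.

Lemma perm_insw w (j : nat) x : perm_eq (insw w j x) (x :: w).
Proof. by rewrite /insw -cat1s perm_catCA /= cat_take_drop. Qed.

Lemma swordsP n w :
  (w \in swords n) = perm_eq [seq absz x | x <- w] (iota 1 n).
Proof.
elim: n w => [|n IH] w.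
  rewrite inE; case: w => //= x w; apply/esym/negP => /perm_size//.
have iotaS : perm_eq (iota 1 n.+1) (n.+1 :: iota 1 n).
  by rewrite -[in iota 1 n.+1](addn1 n) iotaD cats1 perm_rcons add1n.
apply/allpairsP/idP => [[[w' [j b]] [/= w'n _ ->]]|wn].
  rewrite IH in w'n; rewrite (permPr iotaS).
  have := perm_map absz (perm_insw w' j (sgl b n.+1)); move/permPl->.
  by rewrite /= absz_sgl perm_cons.
have : n.+1 \in [seq absz x | x <- w] by rewrite (perm_mem wn) (perm_mem iotaS) mem_head.
case/mapP=> x xw nx; case/splitPr: xw wn => u v wn.
(* Deleting the letter of absolute value n + 1 inverts the insertion; its position and its sign are
   the other two witnesses. *)
exists (u ++ v, (size u, (x < 0)%R)); split => /=.
- rewrite IH -(perm_cons n.+1) -(permPr iotaS) -(permPr wn) perm_sym nx.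
  have := perm_map absz (perm_insw (u ++ v) (size u) x).
  by rewrite /insw take_size_cat// drop_size_cat// => /permPl->.
- have := perm_size wn; rewrite size_map size_iota size_cat /= => sz.
  apply/allpairsP; exists (size u, (x < 0)%R); split => //.
    by rewrite mem_iota /=; lia.
  by rewrite [(_, _).2]/=; case: (_ < _)%R.
- by rewrite /insw take_size_cat// drop_size_cat//; congr (_ ++ _ :: _);
    rewrite /sgl; case: (ltrP x 0) => x0; lia.
Qed.

Lemma size_swords n w : w \in swords n -> size w = n.
Proof. by rewrite swordsP => /perm_size; rewrite size_map size_iota. Qed.

Lemma bounded_swords n w : w \in swords n -> bounded n w.
Proof.
rewrite swordsP => wn; apply/allP => x xw.
have : absz x \in [seq absz y | y <- w] by exact: map_f.
by rewrite (perm_mem wn) mem_iota; lia.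
Qed.

(** The new letter is the only one exceeding n in absolute value: filtering it out recovers the
    word, searching for it recovers the gap. *)
Lemma insw_inj n w w' j j' x x' : bounded n w -> bounded n w' ->
  (j <= size w)%N -> (j' <= size w')%N -> (n < absz x)%N -> (n < absz x')%N ->
  insw w j x = insw w' j' x' -> [/\ w = w', j = j' & x = x'].
Proof.
move=> bw bw' jw jw' nx nx' E.
have F v i y : bounded n v -> (n < absz y)%N ->
    [seq z <- insw v i y | (absz z <= n)%N] = v.
  move=> bv ny; rewrite /insw filter_cat /= leqNgt ny /= -filter_cat cat_take_drop.
  exact/all_filterP.
have G v i y : bounded n v -> (n < absz y)%N -> (i <= size v)%N ->
    find (fun z => (n < absz z)%N) (insw v i y) = i.
  move=> bv ny iv; rewrite /insw find_cat /= ny addn0 size_takel//.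
  rewrite ifN// -all_predC; apply: sub_all (bounded_take i bv) => z /=.
  by rewrite -leqNgt.
have H v i y : (i <= size v)%N -> nth 0 (insw v i y) i = y.
  by move=> iv; rewrite /insw nth_cat size_takel// ltnn subnn.
have Ej : j = j' by rewrite -(G w j x)// E G.
split => //; first by rewrite -(F w j x)// E F.
by rewrite -(H w j x)// E Ej H.
Qed.

Lemma uniq_swords n : uniq (swords n).
Proof.
elim: n => // n IH.
apply: (@allpairs_uniq _ _ _ (fun w jb => insw w jb.1 (sgl jb.2 n.+1))) => //.
  by apply: allpairs_uniq => //; [exact: iota_uniq|move=> [? ?] [? ?]].
have inP w j b : (w, (j, b)) \in [seq (w, jb) | w <- swords n, jb <- signed_gaps n.+1] ->
    w \in swords n /\ (j <= size w)%N.
  case/allpairsP=> -[? [? ?]] [/= wn + [-> -> _]].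
  case/allpairsP=> -[? ?] [+ _ [-> _]]; rewrite mem_iota (size_swords wn).
  by move=> jn; split => //; lia.
move=> [w [j b]] [w' [j' b']] /inP[wn jw] /inP[w'n jw'] /= E.
have := insw_inj (bounded_swords wn) (bounded_swords w'n) jw jw' _ _ E.
rewrite !absz_sgl => /(_ (leqnn _) (leqnn _))[-> ->].
by case: b b' {E} => -[]; rewrite /sgl => //; lia.
Qed.

End Words.

(** * Signed sums over words *)

Section SignedSums.
Variable R : comNzRingType.
Implicit Types (g : nat -> R).

(** [b1] and [b2] switch on the characters (-1)^negs and (-1)^invD, so that the four choices give
    the four characters. *)
Definition signed_sum (b1 b2 : bool) n g : R :=
  \sum_(w <- swords n)
    (-1) ^+ (b1 && odd (negsw w)) * (-1) ^+ (b2 && odd (invw w)) * g (desw 0 w).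

(** [G] is any function of the word, not only of its descents, so that the formula can be applied
    twice in a row. *)
Lemma signed_big b1 b2 n (G : seq int -> R) :
  \sum_(w <- swords n.+1)
    (-1) ^+ (b1 && odd (negsw w)) * (-1) ^+ (b2 && odd (invw w)) * G w =
  \sum_(w <- swords n)
    (-1) ^+ (b1 && odd (negsw w)) * (-1) ^+ (b2 && odd (invw w)) *
    \sum_(j < n.+1) (-1) ^+ (b2 && odd (n - j)) *
      (G (insw w j (sgl false n.+1)) + (-1) ^+ b1 * G (insw w j (sgl true n.+1))).
Proof.
rewrite big_swords [LHS]big_seq [RHS]big_seq.
apply: eq_bigr => w wn; rewrite mulr_sumr; apply: eq_bigr => j _.
have bw := bounded_swords wn; have sw := size_swords wn.
have jw : (j <= size w)%N by rewrite sw -ltnS.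
have nx b : (n < absz (sgl b n.+1))%N by rewrite absz_sgl.
rewrite !negsw_insw !(odd_invw_insw bw (nx _) jw) sw !sgl_lt0 /= add0n.
case: b1 b2 => -[]; case: (odd (negsw w)); case: (odd (invw w)); case: (odd (n - j));
  rewrite /= ?expr0 ?expr1; ring.
Qed.

Lemma desw_insw_sgl n w j b : w \in swords n -> (j < n)%N ->
  desw 0 (insw w j (sgl b n.+1)) =
  (desw 0 w + ~~ (nth 0 w j < nth 0 (0%R :: w) j)%R)%N.
Proof.
move=> wn jn; rewrite (desw_insw (bounded_swords wn)) ?absz_sgl ?(size_swords wn) ?jn//.
exact: ltnW.
Qed.

Lemma desw_insw_end n w b : w \in swords n ->
  desw 0 (insw w n (sgl b n.+1)) = (desw 0 w + b)%N.
Proof.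
move=> wn; rewrite (desw_insw (bounded_swords wn)) ?absz_sgl ?(size_swords wn) ?ltnn//.
by rewrite sgl_lt0.
Qed.

(** In an inner gap the two signs of the new letter give the same number of descents with opposite
    weights; only the end gap survives. *)
Lemma signed_sum_negs b2 n g :
  signed_sum true b2 n.+1 g = signed_sum true b2 n (fun d => g d - g d.+1).
Proof.
rewrite /signed_sum signed_big [LHS]big_seq [RHS]big_seq.
apply: eq_bigr => w wn; congr (_ * _).
rewrite big_ord_recr /= subnn andbF expr0 mul1r !desw_insw_end// addn0 addn1.
rewrite big1 ?add0r ?expr1 ?mulN1r// => j _.
by rewrite !desw_insw_sgl// mulN1r subrr mulr0.
Qed.

(** The d gaps that are descents keep d, the n - d other inner gaps raise it, each for two signs;
    the end gap does one of each. *)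
Lemma signed_sum_eulerian n g :
  signed_sum false false n.+1 g = signed_sum false false n
    (fun d => (2 * d%:R + 1) * g d + (2 * n%:R + 1 - 2 * d%:R) * g d.+1).
Proof.
rewrite /signed_sum signed_big [LHS]big_seq [RHS]big_seq.
apply: eq_bigr => w wn; congr (_ * _).
rewrite big_ord_recr /= !desw_insw_end// addn0 addn1.
under eq_bigr => j _ do rewrite !desw_insw_sgl//.
set d := desw 0 w.
have E (b : bool) : g (d + ~~ b)%N = b%:R * (g d - g d.+1) + g d.+1.
  by case: b; rewrite /= ?addn0 ?addn1; ring.
under eq_bigr => j _ do rewrite E !expr0 !mul1r.
have S (b : 'I_n -> R) (x y : R) :
    \sum_j (b j * x + y + (b j * x + y)) = 2 * ((\sum_j b j) * x + n%:R * y).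
  by rewrite !big_split /= -mulr_suml sumr_const card_ord -mulr_natl; ring.
have D : \sum_(j < n) (nth 0 w j < nth 0 (0%R :: w) j)%R%:R = d%:R :> R.
  by rewrite -natr_sum -(size_swords wn) sum_desw.
by rewrite S D; ring.
Qed.

(** The terms (j, q + 1) and (q, j) with j < q cancel in pairs, leaving the diagonal and the terms
    just above it. *)
Lemma sum_antisym (f : nat -> nat -> R) n :
  (forall j q, (j < q < n)%N -> f j q.+1 = - f q j) ->
  \sum_(j < n) \sum_(k < n.+1) f j k = \sum_(j < n) (f j j + f j j.+1).
Proof.
elim: n => [|n IH] H; first by rewrite !big_ord0.
rewrite [LHS]big_ord_recr [RHS]big_ord_recr /= -IH; last first.
  by move=> j q /andP[jq qn]; apply: H; rewrite jq ltnW.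
under eq_bigr do rewrite big_ord_recr /=.
rewrite big_split /= -addrA; congr (_ + _).
rewrite !big_ord_recr /= addrA addrA -addrA.
rewrite [X in X + _](_ : _ = 0) ?add0r//.
rewrite -big_split big1 //= => j _; rewrite H ?ltn_ord ?ltnSn//.
by rewrite addNr.
Qed.

Lemma insw_size_cat (u v : seq int) x j : size u = j ->
  insw (u ++ v) j x = u ++ x :: v.
Proof. by move=> <-; rewrite /insw take_size_cat// drop_size_cat. Qed.

(** With a nonempty word between them both letters dominate their neighbours, so only their signs
    matter and the absolute values can be exchanged. *)
Lemma desw_two_gaps n (u m v : seq int) b b' : bounded n (u ++ m ++ v) -> m != [::] ->
  desw 0 (u ++ sgl b n.+1 :: m ++ sgl b' n.+2 :: v) =
  desw 0 (u ++ sgl b n.+2 :: m ++ sgl b' n.+1 :: v).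
Proof.
case: m => // y m; rewrite /bounded !all_cat /= => /and3P[bu /andP[yn bm] bv] _.
have bl : (absz (last 0%R u) <= n)%N by exact: bounded_last.
have bl' : (absz (last y m) <= n)%N by exact: bounded_last.
rewrite !(desw_cat 0) !desw_big ?absz_sgl//; try exact: leqW.
rewrite !desw_cat; congr (_ + (_ + _).+1)%N.
have lift k : (n < k)%N -> all (fun x => (absz x < k)%N) v.
  by move=> nk; apply: sub_all bv => x /=; lia.
by apply: desw_same_sign; rewrite ?sgl_lt0 ?absz_sgl ?lift//; exact: leqW.
Qed.

(* The two new letters cancel unless they are adjacent, of the same sign and at
   the end of the word. *)
Lemma signed_sum_inv n g : signed_sum false true n.+2 g =
  signed_sum false true n (fun d => g d - 2 * g d.+1 + g d.+2).
Proof.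
rewrite /signed_sum !signed_big [LHS]big_seq [RHS]big_seq.
apply: eq_bigr => w wn; congr (_ * _).
have bw := bounded_swords wn; have sw := size_swords wn.
(* The letter n + 1 goes with sign [b] to gap j of [w], then n + 2 with sign [b'] to gap k of the
   longer word. *)
pose h j k b b' := g (desw 0 (insw (insw w j (sgl b n.+1)) k (sgl b' n.+2))).
pose f j k : R := (-1) ^+ odd (n - j) * (-1) ^+ odd (n.+1 - k) *
  (h j k false false + h j k false true + h j k true false + h j k true true).
transitivity (\sum_(j < n.+1) \sum_(k < n.+2) f j k).
  apply: eq_bigr => j _; rewrite expr0 mul1r -big_split mulr_sumr.
  by apply: eq_bigr => k _; rewrite /f /h /=; ring.
rewrite sum_antisym; last first.
  move=> j q /andP[jq]; rewrite ltnS => qn.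
  (* Gaps (j, q + 1) and (q, j) put the new letters in the same two places with the absolute values
     exchanged, and the signs (-1)^invD are opposite. *)
  pose u := take j w; pose m := drop j (take q w); pose v := drop q w.
  have w3 : w = u ++ m ++ v.
    have -> : u = take j (take q w) by rewrite take_takel// ltnW.
    by rewrite catA cat_take_drop cat_take_drop.
  have su : size u = j by rewrite size_takel// sw; lia.
  have sm : size m = (q - j)%N by rewrite size_drop size_takel ?sw.
  have m0 : m != [::] by rewrite -size_eq0 sm; lia.
  clearbody u m v.
  have hE b b' : h j q.+1 b b' = h q j b' b.
    have s1 : size (u ++ sgl b n.+1 :: m) = q.+1 by rewrite size_cat /= su sm; lia.
    have s2 : size (u ++ m) = q by rewrite size_cat su sm; lia.
    rewrite /h w3 (insw_size_cat (m ++ v) (sgl b n.+1) su).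
    rewrite -[sgl b n.+1 :: m ++ v]/((sgl b n.+1 :: m) ++ v) [u ++ (_ :: m) ++ v]catA.
    rewrite (insw_size_cat v _ s1) [u ++ m ++ v]catA (insw_size_cat v _ s2).
    rewrite -!catA (insw_size_cat _ (sgl b n.+2) su) desw_two_gaps//.
    by rewrite -w3.
  rewrite /f !hE subSS subSn; last lia.
  rewrite /=; case: (odd (n - j)); case: (odd (n - q)); rewrite /= ?expr0 ?expr1; ring.
(* Now the letters are adjacent: n + 2 stands before n + 1 for [k = j], with sign -1, and after it
   for [k = j.+1], with sign +1. [t b] counts the descents from a new letter of sign [b] onwards. *)
have adj j : (j <= n)%N -> f j j + f j j.+1 =
    let du := desw 0 (take j w) in let t b := desw (sgl b n.+1) (drop j w) in
    g (du + t false)%N - g (du + t false).+1 + g (du + t true).+2 - g (du + t true).+1.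
  move=> jn; pose du := desw 0 (take j w); pose t b := desw (sgl b n.+1) (drop j w).
  rewrite -[RHS]/(g (du + t false)%N - g (du + t false).+1 +
                  g (du + t true).+2 - g (du + t true).+1).
  pose u := take j w; pose v := drop j w.
  have su : size u = j by rewrite size_takel// sw.
  have bl : (absz (last 0%R u) <= n)%N by rewrite bounded_last// bounded_take.
  have bv k : (n < k)%N -> all (fun x => (absz x < k)%N) v.
    move=> nk; move: bw; rewrite -(cat_take_drop j w) /bounded all_cat => /andP[_].
    by apply: sub_all => x /=; lia.
  have w2 : w = u ++ v by rewrite cat_take_drop.
  have tE b : desw (sgl b n.+2) v = t b.
    rewrite /t -/v; move: (v) bv => [//|y v'] /(_ _ (ltnSn n)) /= /andP[yn _].
    by rewrite !desw_cons !gt_sgl// leqW.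
  have h1 b b' : h j j.+1 b b' = g (du + b + b' + t b')%N.
    have su1 : size (rcons u (sgl b n.+1)) = j.+1 by rewrite size_rcons su.
    rewrite /h w2 (insw_size_cat v (sgl b n.+1) su) -cat_rcons.
    rewrite (insw_size_cat v (sgl b' n.+2) su1) cat_rcons desw_cat !desw_cons tE.
    by rewrite !lt_sgl ?absz_sgl// !addnA.
  have h0 b b' : h j j b b' = g (du + t b).+1.
    rewrite /h w2 (insw_size_cat v (sgl b n.+1) su) (insw_size_cat _ (sgl b' n.+2) su).
    rewrite desw_cat desw_big ?absz_sgl// ?addnS//.
    exact: leqW.
  rewrite /f !h1 !h0 subSS subSn//=.
  rewrite !addn0 !addn1 ?addSn ?addnS ?addSn.
  by case: (odd (n - j)); rewrite /= ?expr0 ?expr1; ring.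
(* In an inner gap [t false] is [t true] plus 1 and the four terms cancel; at the end of the word
   both are 0 and the second difference remains. *)
rewrite big_ord_recr /= adj// big1 ?add0r => [|j _].
  rewrite -sw take_size drop_size /= !addn0; ring.
rewrite adj ?(ltnW (ltn_ord j))//=.
have jw : (j < size w)%N by rewrite sw.
rewrite (drop_nth 0 jw) !desw_cons !gt_sgl ?ltnS ?(allP bw) ?mem_nth//.
rewrite /= ?add1n ?add0n ?addnS; ring.
Qed.

End SignedSums.

(** * Signed permutations as words *)

Section WindowWords.
Variable n : nat.
Implicit Types (p q : {perm letter n}) (i j : 'I_n).

Definition word p : seq int := [seq window p i | i <- enum 'I_n].

Lemma size_word p : size (word p) = n.
Proof. by rewrite size_map size_enum_ord. Qed.

Lemma nth_word p i : nth 0 (word p) i = window p i.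
Proof. by rewrite (nth_map i) ?size_enum_ord// nth_ord_enum. Qed.

Lemma window0E p k : window0 p k = nth 0 (0%R :: word p) k.
Proof. by rewrite /window0; case: unliftP => [i ->|->] //=; rewrite nth_word. Qed.

Lemma desB_word p : desB p = desw 0 (word p).
Proof.
rewrite /desB -sum_desw size_word -sum1dep_card big_mkcond /=.
by apply: eq_bigr => i _; rewrite !window0E /=; case: ifP.
Qed.

Lemma negs_word p : negs p = negsw (word p).
Proof.
by rewrite /negs /negsw count_map -sum1_count big_enum_cond -sum1dep_card.
Qed.

Lemma pairsw_sum r w : pairsw r w =
  (\sum_(i < size w) \sum_(j < size w) ((i < j)%N && r (nth 0%R w i) (nth 0%R w j)))%N.
Proof.
elim: w => [|x w IH]; first by rewrite big_ord0.
rewrite big_ord_recl big_ord_recl /= add0n IH; congr addn.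
  rewrite -sum1_count (big_nth 0%R) big_mkord big_mkcond /=.
  by apply: eq_bigr => j _; case: ifP.
by apply: eq_bigr => i _; rewrite big_ord_recl /= add0n.
Qed.

Lemma invD_word p : invD p = invw (word p).
Proof.
rewrite /invD /invw !pairsw_sum size_word.
have E (r : rel int) (P : pred ('I_n * 'I_n)) :
    (forall ij, P ij = (ij.1 < ij.2)%N && r (window p ij.1) (window p ij.2)) ->
    #|[pred ij | P ij]| =
    (\sum_(i < n) \sum_(j < n) ((i < j)%N && r (nth 0%R (word p) i) (nth 0%R (word p) j)))%N.
  move=> PE; rewrite -sum1_card big_mkcond pair_big /=.
  by apply: eq_bigr => ij _; rewrite inE PE !nth_word; case: ifP.
rewrite !cardsE; congr addn.
  exact: (E (fun x y => y < x)%R _ (fun=> erefl)).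
exact: (E (fun x y => y < - x)%R _ (fun=> erefl)).
Qed.

Lemma letter_val_inj : injective (@letter_val n).
Proof.
move=> [i b] [j c]; rewrite /letter_val /=.
move=> E; have [ij bc] : i = j :> nat /\ b = c by case: b c E => -[]; lia.
by rewrite bc; congr pair; apply: val_inj.
Qed.

Lemma signed_permsP p : reflect (forall x, p (letter_opp x) = letter_opp (p x))
  (p \in signed_perms n).
Proof. by rewrite inE; apply: (iffP forallP) => H x; apply/eqP. Qed.

Lemma word_inj : {in signed_perms n &, injective word}.
Proof.
move=> p q /signed_permsP sp /signed_permsP sq pq.
have E i : p (i, false) = q (i, false).
  by apply: letter_val_inj; have := congr1 (fun w => nth 0 w i) pq; rewrite !nth_word.
apply/permP => -[i []]; last exact: E.
by have := sp (i, false); have := sq (i, false); rewrite /letter_opp /= => -> ->; rewrite E.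
Qed.

Lemma absz_letter_val (x : letter n) : absz (letter_val x) = x.1.+1.
Proof. by rewrite /letter_val; case: x.2; rewrite ?abszN. Qed.

Lemma word_in_swords p : p \in signed_perms n -> word p \in swords n.
Proof.
move/signed_permsP=> sp; rewrite swordsP.
have U : uniq [seq absz x | x <- word p].
  rewrite -map_comp map_inj_uniq ?enum_uniq// => i j /=.
  rewrite !absz_letter_val => -[/val_inj ij].
  (* Equal absolute values mean that the image of i is plus or minus that of j, hence the image of
     plus or minus j; injectivity then gives i = j. *)
  have : p (i, false) = p (j, false) \/ p (i, false) = p (j, true).
    have -> : (j, true) = letter_opp (j, false) by [].
    rewrite sp /letter_opp -ij [p (i, false)]surjective_pairing.
    rewrite [in X in X \/ _](surjective_pairing (p (j, false))) -ij.
    by case: (p (i, false)).2; case: (p (j, false)).2; [left|right|right|left].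
  by case=> /perm_inj[].
have S : {subset [seq absz x | x <- word p] <= iota 1 n}.
  move=> k /mapP[x /mapP[i _ ->] ->].
  by rewrite absz_letter_val mem_iota add1n /= ltnS; exact: ltn_ord.
have [|_ E] := uniq_min_size U S; first by rewrite size_map size_word size_iota.
by apply: uniq_perm => //; exact: iota_uniq.
Qed.

Lemma swords_word w : w \in swords n -> exists2 p, p \in signed_perms n & w = word p.
Proof.
move=> wn; have sw := size_swords wn; move: wn; rewrite swordsP => wn.
have W k : (k < n)%N -> (0 < absz (nth 0%R w k) <= n)%N.
  move=> kn; have : absz (nth 0%R w k) \in [seq absz x | x <- w].
    by rewrite map_f// mem_nth// sw.
  by rewrite (perm_mem wn) mem_iota; lia.
(* The odd extension of the word to negative letters. The predecessor is due to 0-based indices; the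
   default of [insubd] is never reached, since the absolute values lie between 1 and n. *)
pose f (x : letter n) : letter n :=
  (insubd x.1 (absz (nth 0%R w x.1)).-1, (nth 0%R w x.1 < 0) (+) x.2).
have f1 x : (f x).1 = (absz (nth 0%R w x.1)).-1 :> nat.
  by rewrite val_insubd ifT//; have := W _ (ltn_ord x.1); lia.
have finj : injective f.
  move=> x y fxy.
  have E : nth 0%N [seq absz z | z <- w] x.1 = nth 0%N [seq absz z | z <- w] y.1.
    rewrite !(nth_map 0%R) ?sw//.
    have := congr1 (fun z : letter n => nat_of_ord z.1) fxy; rewrite !f1.
    by have := W _ (ltn_ord x.1); have := W _ (ltn_ord y.1); lia.
  have /eqP xy : x.1 == y.1.
    rewrite -val_eqE /= -(nth_uniq 0%N (s := [seq absz z | z <- w])) ?size_map ?sw ?E//.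
    by rewrite (perm_uniq wn) iota_uniq.
  have := congr1 snd fxy; rewrite /= xy => /addbI xy2.
  by rewrite [x]surjective_pairing [y]surjective_pairing xy xy2.
have fval x : letter_val (f x) = if x.2 then - nth 0%R w x.1 else nth 0%R w x.1.
  rewrite /letter_val f1; have := W _ (ltn_ord x.1); rewrite /f /=.
  by case: (x.2); case: ltrP => /=; lia.
exists (perm finj).
  apply/signed_permsP => x; rewrite !permE /letter_opp /f /=; congr pair.
  by case: (x.2); case: (_ < _)%R.
apply: (@eq_from_nth _ 0%R); first by rewrite size_word.
rewrite sw => k kn; rewrite -[k]/(val (Ordinal kn)) nth_word /window permE fval //.
Qed.

Lemma big_signed_perms (V : nmodType) (F : seq int -> V) (P : pred (seq int)) :
  \sum_(p in signed_perms n | P (word p)) F (word p) = \sum_(w <- swords n | P w) F w.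
Proof.
rewrite -big_filter_cond -(big_map word P F) /=.
apply: perm_big; apply: uniq_perm.
- rewrite map_inj_in_uniq ?filter_uniq ?index_enum_uniq// => p q.
  by rewrite !mem_filter => /andP[pn _] /andP[qn _]; exact: word_inj.
- exact: uniq_swords.
- move=> w; apply/mapP/idP => [[p]|/swords_word[p pn ->]].
    by rewrite mem_filter => /andP[pn _] ->; exact: word_in_swords.
  by exists p => //; rewrite mem_filter pn mem_index_enum.
Qed.

End WindowWords.

(** * The normal distribution function *)

Section Gaussian.
Local Open Scope classical_set_scope.
Local Open Scope ring_scope.
Variable R : realType.
Implicit Types (x z r h : R).

Definition phi x : R := normal_peak 1 * expR (- (x ^+ 2 / 2)).

Lemma phiE x : normal_pdf 0 1 x = phi x.
Proof.
rewrite normal_pdfE ?oner_eq0// /normal_fun subr0 expr1n /phi mulNr.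
by rewrite -mulr_natl mulr1.
Qed.

(** The identity as a random variable under the normal law: [Phi] is its distribution function and
    inherits its monotonicity and limits. *)
Let idTR : measurableTypeR R -> R := idfun.

#[local] HB.instance Definition _ :=
  @isMeasurableFun.Build _ _ _ _ idTR (@measurable_id _ _ setT).

Let Phi_cdf x :
  (Phi x)%:E = cdf (idTR : {RV (normal_prob (0:R) 1) >-> R}) x.
Proof. by rewrite /Phi fineK// fin_num_measure. Qed.

Lemma Phi_ge0 x : 0 <= Phi x.
Proof. by rewrite -lee_fin Phi_cdf cdf_ge0. Qed.

Lemma Phi_le1 x : Phi x <= 1.
Proof. by rewrite -lee_fin Phi_cdf cdf_le1. Qed.

Lemma Phi_nondecreasing : {homo (@Phi R) : x y / x <= y}.
Proof.
by move=> x y xy; rewrite -lee_fin !Phi_cdf; exact: cdf_nondecreasing.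
Qed.

Lemma Phi_tails (e : R) : 0 < e ->
  exists z, [/\ 0 < z, Phi (- z) <= e & 1 - e <= Phi z].
Proof.
move=> e0.
have Ny : ((@Phi R) x @[x --> -oo] --> (0:R)).
  by have /fine_cvgP[] :=
    @cvg_cdfNy0 _ _ _ _ (idTR : {RV (normal_prob (0:R) 1) >-> R}).
have y1 : ((@Phi R) x @[x --> +oo] --> (1:R)).
  by have /fine_cvgP[] :=
    @cvg_cdfy1 _ _ _ _ (idTR : {RV (normal_prob (0:R) 1) >-> R}).
have [M1 [_ H1]] : \forall x \near -oo, `|0 - (@Phi R) x| <= e.
  by move/cvgrPdist_le: Ny; exact.
have [M2 [_ H2]] : \forall x \near +oo, `|1 - (@Phi R) x| <= e.
  by move/cvgrPdist_le: y1; exact.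
pose z : R := `|M1| + `|M2| + 1.
exists z; split.
- by rewrite /z; have := normr_ge0 M1; have := normr_ge0 M2; lra.
- have /H1 : - z < M1.
    rewrite /z; have := normr_ge0 M2; have := ler_norm (- M1).
    by rewrite normrN; lra.
  by rewrite sub0r normrN ger0_norm// Phi_ge0.
- have /H2 : M2 < z.
    by rewrite /z; have := normr_ge0 M1; have := ler_norm M2; lra.
  by rewrite ger0_norm ?subr_ge0 ?Phi_le1//; lra.
Qed.

Global Instance is_derive_Phi x : is_derive x 1 (@Phi R) (phi x).
Proof.
have [] := @continuous_FTC1 R (normal_pdf 0 1) (BInfty R true) x (x + 1).
- by rewrite ltrDl.
- apply: (integrableS _ _ (@subsetT _ _)) => //; exact: integrable_normal_pdf.
- by rewrite ltNyr.
- by apply: continuous_normal_pdf; rewrite oner_eq0.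
move=> d1 d2; apply: DeriveDef; first exact: d1.
by rewrite -phiE -d2 derive1E.
Qed.

Global Instance is_derive_phi x : is_derive x 1 phi (- x * phi x).
Proof.
have -> : phi = normal_peak 1 *: (expR \o (fun x => (- 2^-1) *: x ^+ 2)).
  by apply/funext => y; rewrite /phi !fctE; congr (_ * expR _); rewrite /GRing.scale /=; ring.
apply: is_derive_eq.
rewrite !fctE /GRing.scale /= !mulr1.
set e := expR _; by field.
Qed.

Lemma phi_ge0 x : 0 <= phi x.
Proof. by rewrite mulr_ge0 ?normal_peak_ge0 ?expR_ge0. Qed.

(** From exp (x^2/2) >= (1 + x^2/4)^2 >= 1 + x^4/16. The one constant 17 then serves for every
    product of [phi] with a polynomial below. *)
Lemma phi_decay x : (1 + x ^+ 4) * phi x <= 17.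
Proof.
have K1 : normal_peak (1 : R) <= 1.
  rewrite /normal_peak invf_le1 ?sqrtr_gt0 expr1n mul1r.
    by rewrite -[leLHS]sqrtr1 ler_sqrt; have := pi_ge2 R; lra.
  by have := pi_ge2 R; lra.
pose e := expR (x ^+ 2 / 4).
have e1 : 1 + x ^+ 2 / 4 <= e by exact: expR_ge1Dx.
have -> : phi x = normal_peak 1 / e ^+ 2.
  rewrite /phi expRN /e -expRM_natl; congr (_ / expR _); lra.
have e0 : 0 < e ^+ 2 by rewrite exprn_gt0 ?expR_gt0.
rewrite mulrA ler_pdivrMr//.
have x0 : 0 <= x ^+ 2 by exact: sqr_ge0.
have H : (1 + x ^+ 2 / 4) ^+ 2 <= e ^+ 2 by rewrite ler_sqr ?nnegrE; lra.
have x4 : 0 <= x ^+ 4 by have -> : x ^+ 4 = (x ^+ 2) ^+ 2; [ring|exact: sqr_ge0].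
apply: (@le_trans _ _ (1 + x ^+ 4)); first by rewrite ler_piMr//; lra.
have E : (1 + x ^+ 2 / 4) ^+ 2 = 1 + x ^+ 2 / 2 + x ^+ 4 / 16 by field.
by rewrite E in H; lra.
Qed.

Lemma mvt_le (f df : R -> R) (M a b : R) : a <= b ->
  (forall x, x \in `[a, b] -> is_derive x 1 f (df x)) ->
  (forall x, x \in `[a, b] -> `|df x| <= M) ->
  `|f b - f a| <= M * (b - a).
Proof.
move=> ab df1 dfM.
have cf : {within `[a, b], continuous f}.
  by apply: derivable_within_continuous => x /df1[].
have dfo x : x \in `]a, b[ -> is_derive x 1 f (df x).
  by move=> xab; apply: df1; exact: subset_itv_oo_cc.
have [c cab ->] := MVT_segment ab dfo cf.
by rewrite normrM (@ger0_norm _ (b - a)) ?subr_ge0// ler_wpM2r ?subr_ge0// dfM.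
Qed.

End Gaussian.

(** * Expansions of the normal distribution function under shift and dilation *)

Section GaussianTaylor.
Local Open Scope classical_set_scope.
Local Open Scope ring_scope.
Variable R : realType.
Implicit Types (x z r h M : R).

(** The mean value theorem in place of integration: the factor 1/(k + 1) is lost, but Taylor bounds
    follow one derivative at a time. *)
Lemma vanishing_le (f df : R -> R) M k : f 0 = 0 ->
  (forall h, is_derive h 1 f (df h)) -> 0 <= M ->
  (forall h, `|df h| <= M * `|h| ^+ k) ->
  forall h, `|f h| <= M * `|h| ^+ k.+1.
Proof.
move=> f0 df1 M0 dfM h.
have mono x : `|x| <= `|h| -> `|df x| <= M * `|h| ^+ k.
  by move=> xh; rewrite (le_trans (dfM x))// ler_wpM2l// lerXn2r ?nnegrE.
have [h0|/ltW h0] := leP 0 h.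
  have := @mvt_le R f df (M * `|h| ^+ k) 0 h h0 (fun x _ => df1 x).
  rewrite f0 !subr0 exprSr mulrA (ger0_norm h0); apply => x.
  rewrite in_itv/= => /andP[x0 xh]; rewrite -(ger0_norm h0) mono//.
  by rewrite !ger0_norm.
have := @mvt_le R f df (M * `|h| ^+ k) h 0 h0 (fun x _ => df1 x).
rewrite f0 !sub0r normrN exprSr mulrA (ler0_norm h0); apply => x.
rewrite in_itv/= => /andP[x0 xh]; rewrite -(ler0_norm h0) mono//.
by rewrite !ler0_norm// lerN2.
Qed.

Lemma poly_phi_le x c : `|c| <= 1 + x ^+ 4 -> `|c * phi x| <= 17.
Proof.
move=> c4; rewrite normrM (ger0_norm (phi_ge0 x)).
by rewrite (le_trans _ (phi_decay x))// ler_wpM2r ?phi_ge0.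
Qed.

Lemma xphi_le x : `|x * phi x| <= 17.
Proof.
apply: poly_phi_le; have := sqr_ge0 (x ^+ 2 - 1/2); have := sqr_ge0 (x - 1/2).
have := sqr_ge0 (x + 1/2).
have -> : (x ^+ 2 - 1/2) ^+ 2 = x ^+ 4 - x ^+ 2 + 1/4 by field.
have -> : (x - 1/2) ^+ 2 = x ^+ 2 - x + 1/4 by field.
have -> : (x + 1/2) ^+ 2 = x ^+ 2 + x + 1/4 by field.
by move=> *; rewrite ler_norml; apply/andP; split; lra.
Qed.

Lemma x3phi_le x : `|x ^+ 3 * phi x| <= 17.
Proof.
apply: poly_phi_le.
have := sqr_ge0 (x ^+ 2 - x); have := sqr_ge0 (x ^+ 2 + x).
have -> : (x ^+ 2 - x) ^+ 2 = x ^+ 4 - 2 * x ^+ 3 + x ^+ 2 by ring.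
have -> : (x ^+ 2 + x) ^+ 2 = x ^+ 4 + 2 * x ^+ 3 + x ^+ 2 by ring.
have := sqr_ge0 (x ^+ 2 - 1/2).
have -> : (x ^+ 2 - 1/2) ^+ 2 = x ^+ 4 - x ^+ 2 + 1/4 by field.
by move=> *; rewrite ler_norml; apply/andP; split; lra.
Qed.

Let is_derive_shift (f : R -> R) (df z h : R) :
  is_derive (z + h) 1 f df -> is_derive h 1 (fun t => f (z + t)) df.
Proof.
move=> d; have d2 : is_derive h 1 (fun t => z + t) (0 + 1).
  exact: (is_deriveD (is_derive_cst _ _ _) (is_derive_id _ _)).
have := @is_derive1_comp R f (fun t => z + t) h _ _ d d2.
by rewrite add0r mulr1.
Qed.

Let is_derive_dilate (f : R -> R) (df z h : R) :
  is_derive (h * z) 1 f df -> is_derive h 1 (fun t => f (t * z)) (z * df).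
Proof.
move=> d; have d2 : is_derive h 1 (fun t => t * z) (h * 0 + z * 1).
  exact: (is_deriveM (is_derive_id _ _) (is_derive_cst _ _ _)).
have := @is_derive1_comp R f (fun t => t * z) h _ _ d d2.
by rewrite mulr0 add0r mulr1 mulrC.
Qed.

Lemma Phi_taylor z h :
  `|Phi (z + h) - Phi z - h * phi z + h ^+ 2 / 2 * (z * phi z)| <=
  17 * `|h| ^+ 3.
Proof.
(* [g1] and [g2] are the first two derivatives of the remainder [g0]; the third is (x^2 - 1) phi x
   at x = z + t, at most 17 in absolute value. *)
pose g2 t := - (z + t) * phi (z + t) + z * phi z.
pose g1 t := phi (z + t) - phi z + t * (z * phi z).
pose g0 t := Phi (z + t) - Phi z - t * phi z + t ^+ 2 / 2 * (z * phi z).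
have dP t := is_derive_shift (is_derive_Phi (z + t)).
have dp t := is_derive_shift (is_derive_phi (z + t)).
have b3 : forall t, `|g2 t| <= 17 * `|t| ^+ 1.
  apply: (@vanishing_le g2 (fun t => ((z + t) ^+ 2 - 1) * phi (z + t))) => //.
  - by rewrite /g2 addr0; ring.
  - by move=> t; rewrite /g2; apply: is_derive_eq; rewrite /GRing.scale/=; ring.
  - move=> t; rewrite expr0 mulr1; apply: poly_phi_le.
    set w := z + t; rewrite ler_norml; have := sqr_ge0 w.
    have : 0 <= w ^+ 4 by exact: exprn_even_ge0.
    have := sqr_ge0 (w ^+ 2 - 1/2).
    have -> : (w ^+ 2 - 1/2) ^+ 2 = w ^+ 4 - w ^+ 2 + 1/4 by field.
    by move=> *; apply/andP; split; lra.
have b2 : forall t, `|g1 t| <= 17 * `|t| ^+ 2.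
  apply: (@vanishing_le g1 g2) => //.
  - by rewrite /g1 addr0; ring.
  - by move=> t; rewrite /g1 /g2; apply: is_derive_eq; rewrite /GRing.scale/=; ring.
apply: (@vanishing_le g0 g1) => //.
- by rewrite /g0 addr0; ring.
- by move=> t; rewrite /g0 /g1; apply: is_derive_eq; rewrite /GRing.scale/=; field.
Qed.

(* r^-2 - 1 is the relative increment of the variance. *)
Lemma Phi_scale z r : 0 < r <= 1 ->
  `|Phi (r * z) - Phi z + (r ^- 2 - 1) / 2 * (z * phi z)| <=
  68 * (r ^- 2 - 1) ^+ 2.
Proof.
case/andP=> r0 r1.
(* First-order expansion of t |-> Phi (t z) at t = 1; [g1] is the derivative of the remainder [g0],
   and its own derivative is - (t z)^3 phi (t z) / t^2. *)
pose g1 t := z * phi (t * z) - z * phi z.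
pose g0 t := Phi (t * z) - (t - 1) * (z * phi z).
have dP t := is_derive_dilate (is_derive_Phi (t * z)).
have dp t := is_derive_dilate (is_derive_phi (t * z)).
have r2 : 0 < r ^- 2 by rewrite invr_gt0 exprn_gt0.
have r1' : 0 <= 1 - r by rewrite subr_ge0.
have b1 t : r <= t <= 1 -> `|g1 t| <= 17 * r ^- 2 * (1 - r).
  case/andP=> rt t1; rewrite -normrN /g1 opprB.
  apply: (@le_trans _ _ (17 * r ^- 2 * (1 - t))); last first.
    by apply: ler_wpM2l; [rewrite mulr_ge0// ltW|lra].
  have -> : z * phi z = z * phi (1 * z) by rewrite mul1r.
  pose dg u := z * (z * (- (u * z) * phi (u * z))).
  have dgP (u : R) : is_derive u 1 (fun t => z * phi (t * z)) (dg u).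
    by apply: is_derive_eq; rewrite /GRing.scale/= /dg; ring.
  apply: (@mvt_le R (fun t => z * phi (t * z)) dg _ _ _ t1 (fun u _ => dgP u)).
  move=> u; rewrite in_itv/= => /andP[tu u1]; rewrite /dg.
  have u0 : 0 < u by exact: lt_le_trans r0 (le_trans rt tu).
  have -> : z * (z * (- (u * z) * phi (u * z))) =
            - (((u * z) ^+ 3 * phi (u * z)) * u ^- 2).
    by field; rewrite gt_eqF.
  rewrite normrN normrM ler_pM// ?x3phi_le//.
  rewrite ger0_norm; last by rewrite invr_ge0 exprn_ge0 ?ltW.
  rewrite lef_pV2 ?posrE ?exprn_gt0//.
  by apply: lerXn2r; rewrite ?nnegrE; [exact: ltW|exact: ltW|exact: le_trans rt tu].
have b0 : `|g0 1 - g0 r| <= 17 * r ^- 2 * (1 - r) * (1 - r).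
  have dg0 (u : R) : is_derive u 1 g0 (g1 u).
    by rewrite /g0 /g1; apply: is_derive_eq; rewrite /GRing.scale/=; ring.
  apply: (@mvt_le R g0 g1 _ _ _ r1 (fun u _ => dg0 u)).
  by move=> t; rewrite in_itv/=; exact: b1.
(* The expansion has 1 - r where (r^-2 - 1)/2 is wanted; they differ by (1 - r)^2 (1 + 2 r) / (2
   r^2), of second order. *)
have -> : Phi (r * z) - Phi z + (r ^- 2 - 1) / 2 * (z * phi z) =
   - (g0 1 - g0 r) + (z * phi z) * ((1 - r) ^+ 2 * (1 + 2 * r) / 2 * r ^- 2).
  rewrite /g0 mul1r; set P := Phi _; set Q := Phi _; set p := phi _.
  by field; rewrite gt_eqF.
have q0 : 0 <= (1 - r) / r by rewrite divr_ge0// ltW.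
have ql : ((1 - r) / r) <= (r ^- 2 - 1).
  have -> : r ^- 2 - 1 = (1 - r) / r * ((1 + r) / r) by field; rewrite gt_eqF.
  by rewrite ler_peMr// ler_pdivlMr//; lra.
apply: (@le_trans _ _ (68 * ((1 - r) / r) ^+ 2)); last first.
  by rewrite ler_wpM2l// lerXn2r ?nnegrE// (le_trans q0).
apply: le_trans (ler_normD _ _) _; rewrite normrN.
have b2 : `|z * phi z * ((1 - r) ^+ 2 * (1 + 2 * r) / 2 * r ^- 2)| <=
          17 * (((1 - r) / r) ^+ 2 * 2).
  rewrite normrM ler_pM// ?xphi_le//.
  have -> : (1 - r) ^+ 2 * (1 + 2 * r) / 2 * r ^- 2 =
            ((1 - r) / r) ^+ 2 * ((1 + 2 * r) / 2).
    by field; rewrite gt_eqF.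
  rewrite normrM ger0_norm ?sqr_ge0// ler_wpM2l ?sqr_ge0// ger0_norm; lra.
have E : 17 * r ^- 2 * (1 - r) * (1 - r) = 17 * ((1 - r) / r) ^+ 2.
  by field; rewrite gt_eqF.
rewrite E in b0; have := sqr_ge0 ((1 - r) / r); lra.
Qed.

Lemma Phi_lip x y : x <= y -> Phi y - Phi x <= 17 * (y - x).
Proof.
move=> xy; apply: le_trans (ler_norm _) _.
apply: (@mvt_le _ _ (@phi R)) => // c _.
by rewrite -[phi c]mul1r poly_phi_le// normr1 lerDl exprn_even_ge0.
Qed.
End GaussianTaylor.

(** * The type B Eulerian law *)

Section EulerianLaw.
Variable R : realType.
Implicit Types (f g : nat -> R) (F G : R -> R).

(* The expectation of g (des_B) over B_n, see [signed_sum_eulB]. *)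
Fixpoint eulB n g : R :=
  if n is m.+1 then
    eulB m (fun d => ((2 * d%:R + 1) * g d + (2 * m%:R + 1 - 2 * d%:R) * g d.+1)
                     / (2 * m.+1%:R))
  else g 0.

(** The weights 2 d + 1 and 2 n + 1 - 2 d are nonnegative on the range d <= n of des_B. *)
Lemma eulB_le n f g : (forall d, (d <= n)%N -> f d <= g d) -> eulB n f <= eulB n g.
Proof.
elim: n f g => [|n IH] f g fg; first exact: fg.
apply: IH => d dn; rewrite ler_wpM2r ?invr_ge0// lerD//.
  have d0 : 0 <= d%:R :> R by [].
  by apply: ler_wpM2l; [lra|apply: fg; exact: leqW].
apply: ler_wpM2l; last exact: fg.
by move: dn; rewrite -(ler_nat R); lra.
Qed.

Lemma eq_eulB n f g : (forall d, (d <= n)%N -> f d = g d) -> eulB n f = eulB n g.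
Proof. by move=> fg; apply: le_anti; rewrite !eulB_le// => d /fg->. Qed.

Lemma eulB_lin n a f g :
  eulB n (fun d => a * f d + g d) = a * eulB n f + eulB n g.
Proof.
elim: n f g => //= n IH f g; rewrite -IH; apply: eq_eulB => d _.
by field.
Qed.

Lemma eulB_const n a : eulB n (fun=> a) = a.
Proof.
elim: n => //= n IH; rewrite -[RHS]IH; apply: eq_eulB => d _.
by rewrite -natr1; field; rewrite nat1r.
Qed.

(** Expectation of G (Y) for the centred variable Y = des_B - n/2. *)
Definition cE n G := eulB n (fun d => G (d%:R - n%:R / 2)).

Lemma cE_le n F G : (forall y, `|y| <= n%:R / 2 -> F y <= G y) -> cE n F <= cE n G.
Proof.
move=> FG; apply: eulB_le => d dn; apply: FG.
have d0 : 0 <= d%:R :> R by [].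
by move: dn; rewrite -(ler_nat R) ler_norml => dn; apply/andP; split; lra.
Qed.

Lemma eq_cE n F G : (forall y, `|y| <= n%:R / 2 -> F y = G y) -> cE n F = cE n G.
Proof. by move=> FG; apply: le_anti; rewrite !cE_le// => d /FG->. Qed.

Lemma cE_lin n a F G : cE n (fun y => a * F y + G y) = a * cE n F + cE n G.
Proof. exact: eulB_lin. Qed.

Lemma cE_const n a : cE n (fun=> a) = a.
Proof. exact: eulB_const. Qed.

Lemma cE0 G : cE 0 G = G 0.
Proof. by rewrite /cE /= mul0r subr0. Qed.

(** The transition of the chain: with d = y + n/2 the weight (2 d + 1) / (2 (n + 1)) becomes 1/2 +
    y/(n + 1). *)
Lemma cES n G : cE n.+1 G =
  cE n (fun y => (1/2 + y / n.+1%:R) * G (y - 1/2) +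
                 (1/2 - y / n.+1%:R) * G (y + 1/2)).
Proof.
rewrite /cE /=; apply: eq_eulB => d _.
have -> : d.+1%:R - n.+1%:R / 2 = d%:R - n%:R / 2 + 1/2 :> R.
  by rewrite -!natr1; field.
have -> : d%:R - n.+1%:R / 2 = d%:R - n%:R / 2 - 1/2 :> R.
  by rewrite -natr1; field.
by rewrite -natr1; field; rewrite nat1r.
Qed.

Lemma cE_norm n F G B : (forall y, `|y| <= n%:R / 2 -> `|F y - G y| <= B y) ->
  `|cE n F - cE n G| <= cE n B.
Proof.
move=> FG; rewrite ler_norml; apply/andP; split.
  have : cE n (fun y => -1 * B y + G y) <= cE n F.
    by apply: cE_le => y /FG; rewrite ler_norml => /andP[]; lra.
  by rewrite cE_lin; lra.
have : cE n F <= cE n (fun y => 1 * B y + G y).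
  by apply: cE_le => y /FG; rewrite ler_norml => /andP[]; lra.
by rewrite cE_lin; lra.
Qed.

Lemma cE_mean n : cE n id = 0.
Proof.
elim: n => [|n IH]; first by rewrite cE0.
have <- : (1 - n.+1%:R^-1) * cE n id + cE n (fun=> 0) = 0.
  by rewrite IH cE_const mulr0 addr0.
rewrite cES -cE_lin; apply: eq_cE => y _.
by rewrite -natr1; field; rewrite nat1r.
Qed.

Lemma cE_sqrS n :
  cE n.+1 (fun y => y ^+ 2) = (1 - 2 / n.+1%:R) * cE n (fun y => y ^+ 2) + 1/4.
Proof.
rewrite cES -[1/4](cE_const n) -cE_lin; apply: eq_cE => y _.
by rewrite -natr1; field; rewrite nat1r.
Qed.

(** The factor 1 - 2/(n + 1) of the recursion vanishes at n = 1, which forces the value 1/4 at 2;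
    the recursion then preserves (n + 1)/12. *)
Lemma cE_sqr n : (2 <= n)%N -> cE n (fun y => y ^+ 2) = n.+1%:R / 12.
Proof.
elim: n => [//|n IH]; rewrite ltnS leq_eqVlt => /predU1P[<-|n2].
  by rewrite cE_sqrS divff// subrr mul0r; lra.
by rewrite cE_sqrS IH// -!natr1; field; rewrite natr1.
Qed.

Lemma cE_sqr_le n : cE n (fun y => y ^+ 2) <= n%:R / 4.
Proof.
case: n => [|[|n]].
- by rewrite cE0 expr0n mul0r.
- by rewrite cE_sqrS cE0 expr0n mulr0 add0r; lra.
- rewrite cE_sqr// -[n.+3]addn3 -[n.+2]addn2 !natrD.
  by have : 0 <= n%:R :> R by []; lra.
Qed.

End EulerianLaw.

(** * The smoothed central limit theorem *)

Section CentralLimit.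
Variable R : realType.
Implicit Types (x y z c k : R).

(** A centred two-point step against a dilation: the second-order term of [Phi_taylor] cancels that
    of [Phi_scale] (the heat equation), up to the variance defect [t]. *)
Lemma Phi_two_point (z q1 q2 h1 h2 r t H : R) :
  0 <= q1 -> 0 <= q2 -> q1 + q2 = 1 -> q1 * h1 + q2 * h2 = 0 ->
  q1 * h1 ^+ 2 + q2 * h2 ^+ 2 = r ^- 2 - 1 - t -> 0 <= t ->
  `|h1| <= H -> `|h2| <= H -> 0 < r <= 1 ->
  `|q1 * Phi (z + h1) + q2 * Phi (z + h2) - Phi (r * z)| <=
  17 * H ^+ 3 + 17 * t + 68 * (r ^- 2 - 1) ^+ 2.
Proof.
move=> q10 q20 q12 qh qhh t0 h1H h2H r01.
have T1 := Phi_taylor z h1; have T2 := Phi_taylor z h2.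
have S := Phi_scale z r01; have X := xphi_le z.
have C (h : R) : `|h| <= H -> 17 * `|h| ^+ 3 <= 17 * H ^+ 3.
  by move=> hH; rewrite ler_wpM2l// lerXn2r ?nnegrE ?(le_trans _ hH).
have {}T1 := le_trans T1 (C _ h1H); have {}T2 := le_trans T2 (C _ h2H).
move: S; set l := r ^- 2 - 1 => S.
rewrite -/l in qhh.
move: T1 T2 S X; set a1 := _ + h1 ^+ 2 / 2 * _; set a2 := _ + h2 ^+ 2 / 2 * _.
set s := _ + l / 2 * _; set w := z * phi z => T1 T2 S X.
have -> : q1 * Phi (z + h1) + q2 * Phi (z + h2) - Phi (r * z) =
   q1 * a1 + q2 * a2 - s + t / 2 * w.
  have -> : q1 * a1 + q2 * a2 = q1 * Phi (z + h1) + q2 * Phi (z + h2)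
     - (q1 + q2) * Phi z - (q1 * h1 + q2 * h2) * phi z
     + (q1 * h1 ^+ 2 + q2 * h2 ^+ 2) / 2 * w by rewrite /a1 /a2 /w; ring.
  by rewrite q12 qh qhh /s /w; field.
apply: le_trans (ler_normD _ _) _; apply: le_trans (lerD (ler_normB _ _) (lexx _)) _.
have A : `|q1 * a1 + q2 * a2| <= 17 * H ^+ 3.
  apply: le_trans (ler_normD _ _) _; rewrite !normrM (ger0_norm q10) (ger0_norm q20).
  have -> : 17 * H ^+ 3 = q1 * (17 * H ^+ 3) + q2 * (17 * H ^+ 3).
    by rewrite -mulrDl q12 mul1r.
  by rewrite lerD// ler_wpM2l.
have B : `|t / 2 * w| <= t / 2 * 17.
  by rewrite normrM ger0_norm ?ler_wpM2l// divr_ge0.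
lra.
Qed.

(* Telescoping along the chain [cES]: v n - v n.+1 is the variance of its step
   after rescaling by n.+1 / N, up to y^2 / N^2. *)
Lemma cE_Phi N k c : (0 < N)%N -> 0 < k ->
  `|cE N (fun y => Phi ((c - y) / k)) -
    Phi (c / Num.sqrt (k ^+ 2 + N.+1%:R * (2 * N%:R + 1) / (24 * N%:R)))| <=
  N%:R * (17 / k ^+ 3 + 68 / k ^+ 4 + 17 / (N%:R * k ^+ 2)).
Proof.
move=> N0 k0.
(* [S n] is 6 times the sum of the squares up to n, so [v n] is k^2 plus the sum of m^2 / (4 N^2)
   over n < m <= N, the variance still to come. *)
pose S n : R := n%:R * n.+1%:R * (2 * n%:R + 1).
pose v n : R := k ^+ 2 + (S N - S n) / (24 * N%:R ^+ 2).
pose F n y := Phi ((c - n%:R / N%:R * y) / Num.sqrt (v n)).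
have Nr : 0 < N%:R :> R by rewrite ltr0n.
have N2 : 0 < 24 * N%:R ^+ 2 :> R by rewrite mulr_gt0// exprn_gt0.
have kk : 0 < k ^+ 2 by rewrite exprn_gt0.
have vk n : (n <= N)%N -> k ^+ 2 <= v n.
  move=> nN; rewrite lerDl divr_ge0 ?(ltW N2)// subr_ge0 /S.
  have nN' : n%:R <= N%:R :> R by rewrite ler_nat.
  have n0 : 0 <= n%:R :> R by [].
  rewrite -!natr1; apply: ler_pM; rewrite ?mulr_ge0//; try lra.
  by apply: ler_pM => //; lra.
have FN : cE N (fun y => Phi ((c - y) / k)) = cE N (F N).
  apply: eq_cE => y _; rewrite /F /v subrr mul0r addr0 divff ?gt_eqF// mul1r.
  by rewrite sqrtr_sqr gtr0_norm.
have F0 : cE 0 (F 0) =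
    Phi (c / Num.sqrt (k ^+ 2 + N.+1%:R * (2 * N%:R + 1) / (24 * N%:R))).
  rewrite cE0 /F mulr0 subr0 /v; congr (Phi (c / Num.sqrt (_ + _))).
  by rewrite /S !mul0r subr0; field; rewrite gt_eqF.
rewrite FN -F0.
set B := _ + 17 / _.
suff : forall n, (n <= N)%N -> `|cE n (F n) - cE 0 (F 0)| <= n%:R * B by exact.
elim=> [_|n IH nN]; first by rewrite subrr normr0 mul0r.
have {}IH := IH (ltnW nN).
rewrite -[_ - _](subrKA (cE n (F n))); apply: le_trans (ler_normD _ _) _.
rewrite -natr1 mulrDl mul1r [leRHS]addrC; apply: lerD; last exact: IH.
rewrite cES.
have nN' : n.+1%:R <= N%:R :> R by rewrite ler_nat.
have nS : n.+1%:R = n%:R + 1 :> R by rewrite natr1.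
have m0 : 0 < n.+1%:R :> R by rewrite ltr0n.
pose rho := Num.sqrt (v n.+1).
have v0 : 0 < v n.+1 by exact: lt_le_trans kk (vk _ nN).
have vE : v n = v n.+1 + n.+1%:R ^+ 2 / (4 * N%:R ^+ 2).
  by rewrite /v /S -[n.+2]addn2 natrD nS; field; rewrite gt_eqF.
have vn0 : 0 < v n by exact: lt_le_trans kk (vk _ (ltnW nN)).
have rho0 : 0 < rho by rewrite sqrtr_gt0.
have rhok : k <= rho.
  by rewrite -[k]gtr0_norm// -sqrtr_sqr ler_wsqrtr// vk.
have rho2 : rho ^+ 2 = v n.+1 by rewrite sqr_sqrtr// ltW.
pose r := rho / Num.sqrt (v n).
have r0 : 0 < r by rewrite divr_gt0// sqrtr_gt0.
have r2 : r ^- 2 - 1 = n.+1%:R ^+ 2 / (4 * N%:R ^+ 2) / rho ^+ 2.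
  rewrite /r expr_div_n invf_div (sqr_sqrtr (ltW vn0)) vE -rho2.
  by field; rewrite !gt_eqF.
have r1 : r <= 1.
  rewrite /r ler_pdivrMr ?sqrtr_gt0// mul1r ler_wsqrtr// vE lerDl.
  by rewrite divr_ge0// ?sqr_ge0// mulr_ge0// sqr_ge0.
(* The error of one step is kept as a function of y, and its y^2 term is averaged by [cE_sqr_le]. *)
apply: (@le_trans _ _ (cE n (fun y => 17 / (N%:R ^+ 2 * k ^+ 2) * y ^+ 2 +
                                (17 / k ^+ 3 + 68 / k ^+ 4)))); last first.
  rewrite cE_lin cE_const /B [leLHS]addrC lerD2l.
  have -> : 17 / (N%:R * k ^+ 2) = 17 / (N%:R ^+ 2 * k ^+ 2) * N%:R.
    by field; rewrite !gt_eqF.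
  apply: ler_wpM2l; first by rewrite divr_ge0// mulr_ge0 ?sqr_ge0.
  by apply: (le_trans (cE_sqr_le R n)); lra.
apply: cE_norm => y yn.
have ny : `|y / n.+1%:R| <= 1 / 2.
  rewrite normrM normfV (gtr0_norm m0) ler_pdivrMr//.
  by lra.
pose z := (c - n%:R / N%:R * y) / rho.
(* Rescaled increments of c - (n/N) y when y moves by -1/2 or 1/2; the factor n/N is what makes
   their mean 0. *)
pose h1 := (- y + n.+1%:R / 2) / N%:R / rho.
pose h2 := (- y - n.+1%:R / 2) / N%:R / rho.
have -> : F n.+1 (y - 1/2) = Phi (z + h1).
  by rewrite /F -/rho /z /h1; congr (Phi _); rewrite nS; field; rewrite !gt_eqF.
have -> : F n.+1 (y + 1/2) = Phi (z + h2).
  by rewrite /F -/rho /z /h2; congr (Phi _); rewrite nS; field; rewrite !gt_eqF.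
have -> : F n y = Phi (r * z).
  rewrite /F /r /z; congr (Phi _); field.
  by rewrite !gt_eqF// sqrtr_gt0.
have hH (e : R) : `|e| <= n.+1%:R / 2 -> `|(- y + e) / N%:R / rho| <= k^-1.
  move=> em; rewrite -mulrA normrM -invfM normfV (@gtr0_norm _ (_ * _)); last exact: mulr_gt0.
  rewrite ler_pdivrMr ?mulr_gt0//.
  apply: (@le_trans _ _ N%:R).
    apply: le_trans (ler_normD _ _) _; rewrite normrN.
    by lra.
  by rewrite mulrCA ler_peMr// mulrC ler_pdivlMr// mul1r.
have ge0m : `|n.+1%:R / 2 : R| <= n.+1%:R / 2 by rewrite ger0_norm// divr_ge0.
have q10 : 0 <= 1/2 + y / n.+1%:R by move: ny; rewrite ler_norml; set w := y / _ => /andP[? ?]; lra.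
have q20 : 0 <= 1/2 - y / n.+1%:R by move: ny; rewrite ler_norml; set w := y / _ => /andP[? ?]; lra.
have q12 : (1/2 + y / n.+1%:R) + (1/2 - y / n.+1%:R) = 1 by field; rewrite gt_eqF.
have qh : (1/2 + y / n.+1%:R) * h1 + (1/2 - y / n.+1%:R) * h2 = 0.
  by rewrite /h1 /h2; field; rewrite !gt_eqF.
have qhh : (1/2 + y / n.+1%:R) * h1 ^+ 2 + (1/2 - y / n.+1%:R) * h2 ^+ 2 =
    r ^- 2 - 1 - y ^+ 2 / N%:R ^+ 2 / rho ^+ 2.
  by rewrite r2 /h1 /h2; field; rewrite !gt_eqF.
have t0 : 0 <= y ^+ 2 / N%:R ^+ 2 / rho ^+ 2 by rewrite !divr_ge0// sqr_ge0.
have h1k : `|h1| <= k^-1 by exact: hH.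
have h2k : `|h2| <= k^-1 by apply: hH; rewrite normrN.
have r01 : 0 < r <= 1 by rewrite r0 r1.
apply: le_trans (Phi_two_point z q10 q20 q12 qh qhh t0 h1k h2k r01) _.
have kr2 : k ^+ 2 <= rho ^+ 2 by rewrite lerXn2r ?nnegrE// ltW.
have A : y ^+ 2 / N%:R ^+ 2 / rho ^+ 2 <= y ^+ 2 / (N%:R ^+ 2 * k ^+ 2).
  rewrite -mulrA -invfM ler_wpM2l ?sqr_ge0// lef_pV2 ?posrE ?mulr_gt0 ?exprn_gt0//.
  by rewrite ler_wpM2l ?sqr_ge0.
have C : (r ^- 2 - 1) ^+ 2 <= k ^- 4.
  have -> : k ^- 4 = (k ^- 2) ^+ 2 by rewrite exprVn -exprM.
  rewrite r2; set d := _ / (4 * _).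
  have d0 : 0 <= d by rewrite divr_ge0 ?mulr_ge0 ?sqr_ge0.
  have d1 : d <= 1.
    rewrite ler_pdivrMr ?mulr_gt0 ?exprn_gt0// mul1r.
    have : n.+1%:R ^+ 2 <= N%:R ^+ 2 :> R by rewrite lerXn2r ?nnegrE.
    by have := sqr_ge0 (N%:R : R); lra.
  have dk : d / rho ^+ 2 <= k ^- 2.
    rewrite -[leRHS]mul1r; apply: ler_pM => //; first by rewrite invr_ge0 sqr_ge0.
    by rewrite lef_pV2 ?posrE ?exprn_gt0.
  apply: lerXn2r dk; rewrite nnegrE; first by rewrite divr_ge0 ?sqr_ge0.
  by rewrite invr_ge0 sqr_ge0.
rewrite exprVn.
have -> : 17 / (N%:R ^+ 2 * k ^+ 2) * y ^+ 2 = 17 * (y ^+ 2 / (N%:R ^+ 2 * k ^+ 2)).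
  by rewrite mulrAC mulrA.
by lra.
Qed.

End CentralLimit.

(** * Uniform convergence *)

Section Kolmogorov.
Variable R : realType.
Implicit Types (x y z c e d : R).

(* s is the standard deviation and e s the width of the smoothing. *)
Lemma smoothing_error (N : nat) e eta s : (0 < N)%N -> 0 < e -> 0 < eta ->
  s ^+ 2 = N.+1%:R / 12 -> 1 <= e * s -> (1020 / e ^+ 2 + 17) / eta <= e * s ->
  N%:R * (17 / (e * s) ^+ 3 + 68 / (e * s) ^+ 4 + 17 / (N%:R * (e * s) ^+ 2))
    <= eta.
Proof.
move=> N0 e0 eta0 s2 k1; set k := e * s => kA.
have {k1}k1 : 1 <= k by [].
have k0 : 0 < k by exact: lt_le_trans k1.
have Nr : 0 < N%:R :> R by rewrite ltr0n.
have Nk : N%:R <= 12 / e ^+ 2 * k ^+ 2.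
  have -> : 12 / e ^+ 2 * k ^+ 2 = N.+1%:R.
    by rewrite /k exprMn s2; field; rewrite gt_eqF.
  by rewrite ler_nat.
have kV : k^-1 <= 1 by rewrite invf_le1.
have kV0 : 0 < k^-1 by rewrite invr_gt0.
have -> : N%:R * (17 / k ^+ 3 + 68 / k ^+ 4 + 17 / (N%:R * k ^+ 2)) =
  N%:R * k ^- 2 * (17 + 68 * k^-1) * k^-1 + 17 * k^-1 * k^-1.
  by field; rewrite !gt_eqF.
have A : N%:R * k ^- 2 <= 12 / e ^+ 2 by rewrite ler_pdivrMr// exprn_gt0.
have A0 : 0 <= N%:R * k ^- 2 by rewrite mulr_ge0// invr_ge0 sqr_ge0.
have B : N%:R * k ^- 2 * (17 + 68 * k^-1) <= 12 / e ^+ 2 * 85.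
  by apply: ler_pM => //; lra.
apply: (@le_trans _ _ ((1020 / e ^+ 2 + 17) * k^-1)); last first.
  by rewrite ler_pdivrMr// [leRHS]mulrC -ler_pdivrMr.
rewrite [leRHS]mulrDl; apply: lerD.
  rewrite ler_wpM2r ?(ltW kV0)//; apply: (le_trans B).
  by rewrite mulrAC -natrM.
by rewrite -mulrA ler_wpM2l// ler_piMr// ltW.
Qed.

(** [Phi_scale] at r = (1 + l)^(-1/2), where r^-2 - 1 = l; the constants add up to 17/2 + 68 <=
    80. *)
Lemma Phi_dilate_le x l : 0 <= l <= 1 ->
  `|Phi (x / Num.sqrt (1 + l)) - Phi x| <= 80 * l.
Proof.
case/andP=> l0 l1.
have l1' : 0 < 1 + l by lra.
have s0 : 0 < Num.sqrt (1 + l) by rewrite sqrtr_gt0.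
have r01 : 0 < (Num.sqrt (1 + l))^-1 <= 1.
  rewrite invr_gt0 s0 invf_le1// -[leLHS]sqrtr1 ler_wsqrtr//; lra.
have := Phi_scale x r01; rewrite exprVn invrK sqr_sqrtr ?(ltW l1')//.
rewrite [1 + l]addrC addrK [l + 1]addrC [_^-1 * x]mulrC => S.
have X := xphi_le x.
rewrite -[X in `|X|](addrK (l / 2 * (x * phi x))).
apply: le_trans (ler_normB _ _) _.
have : `|l / 2 * (x * phi x)| <= l / 2 * 17.
  by rewrite normrM ger0_norm ?divr_ge0// ler_wpM2l// divr_ge0.
have : l ^+ 2 <= l by rewrite expr2 ler_piMr.
lra.
Qed.

Lemma Phi_shift_dilate_le x d l : 0 <= l <= 1 ->
  `|Phi ((x + d) / Num.sqrt (1 + l)) - Phi x| <= 17 * `|d| + 80 * l.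
Proof.
move=> l01; have /andP[l0 l1] := l01.
have s1 : 1 <= Num.sqrt (1 + l) by rewrite -[leLHS]sqrtr1 ler_wsqrtr//; lra.
have s0 : 0 < Num.sqrt (1 + l) by exact: lt_le_trans s1.
rewrite -[_ - _](subrKA (Phi (x / Num.sqrt (1 + l)))).
apply: le_trans (ler_normD _ _) _; apply: lerD; last exact: Phi_dilate_le.
have lip (u w : R) : `|Phi u - Phi w| <= 17 * `|u - w|.
  wlog uw : u w / w <= u => [H|].
    have [/H//|/ltW/H] := leP w u; by rewrite distrC [`|w - u|]distrC.
  by rewrite !ger0_norm ?subr_ge0 ?Phi_nondecreasing// Phi_lip.
apply: le_trans (lip _ _) _; rewrite ler_wpM2l// -mulrBl addrAC subrr add0r.
by rewrite normrM normfV (gtr0_norm s0) ler_pdivrMr// ler_peMr.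
Qed.

(** The indicator of y <= x s is squeezed, up to eta/4, between two smoothings of width k = e s
    centred at (x - d) s and (x + d) s. *)
Theorem cE_clt eta : 0 < eta -> exists N0, forall N, (N0 <= N)%N -> forall x,
  `|cE N (fun y => (y <= x * Num.sqrt (N.+1%:R / 12))%R%:R) - Phi x| <= eta.
Proof.
move=> eta0.
have [z [z0 zN zP]] := @Phi_tails R (eta / 4) (divr_gt0 eta0 (ltr0n _ 4)).
pose d := eta / 200.
have d0 : 0 < d by rewrite divr_gt0.
have D0 : 0 < z + 2 * d + 30 by lra.
(* The three terms of the denominator ensure d/e >= z, e <= 1/2 and 30 e <= d. *)
pose e := d / (z + 2 * d + 30).
have e0 : 0 < e by rewrite divr_gt0.
have ed : e * (z + 2 * d + 30) = d by rewrite /e divfK// gt_eqF.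
have ez : z <= d / e by rewrite ler_pdivlMr// -ed mulrC ler_wpM2l ?ltW//; lra.
have e30 : 30 * e <= d by rewrite -[leRHS]ed mulrC ler_wpM2l ?ltW//; lra.
have e1 : e <= 1 / 2.
  rewrite ler_pdivrMr//; lra.
have e2 : 0 < e ^+ 2 by rewrite exprn_gt0.
have ee : e ^+ 2 <= e / 2.
  by rewrite expr2 -[2^-1]div1r ler_wpM2l// ltW.
pose A := (1020 / e ^+ 2 + 17) / (eta / 4).
have A0 : 0 <= A.
  apply: divr_ge0; last by lra.
  have i0 : 0 < e ^- 2 by rewrite invr_gt0; exact: e2.
  apply: addr_ge0; last exact: ler0n.
  by apply: mulr_ge0; [exact: ler0n|exact: ltW].
(* The second bound gives 1 + A <= e s, as [smoothing_error] requires; the third gives 1/N <=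
   e^2. *)
exists (maxn 1 (maxn (Num.truncn (12 * ((1 + A) / e) ^+ 2)).+1
                     (Num.truncn (e ^- 2)).+1)) => N.
rewrite !geq_max => /and3P[N1 N2 N3] x.
have {}N2 : 12 * ((1 + A) / e) ^+ 2 <= N%:R.
  by apply: le_trans (ltW (truncnS_gt _)) _; rewrite ler_nat; exact: N2.
have {}N3 : e ^- 2 <= N%:R.
  by apply: le_trans (ltW (truncnS_gt _)) _; rewrite ler_nat; exact: N3.
have Nr : 0 < N%:R :> R by rewrite ltr0n.
pose s := Num.sqrt (N.+1%:R / 12 : R); rewrite -/s.
have s2 : s ^+ 2 = N.+1%:R / 12 by rewrite sqr_sqrtr.
have s0 : 0 < s by rewrite sqrtr_gt0.
have kA : 1 + A <= e * s.
  rewrite mulrC -ler_pdivrMr//.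
  rewrite -[leLHS]ger0_norm; last by apply: divr_ge0; [lra|exact: ltW].
  rewrite -sqrtr_sqr ler_wsqrtr// ler_pdivlMr// mulrC.
  by apply: (le_trans N2); rewrite ler_nat.
have Ne : N%:R^-1 <= e ^+ 2.
  by rewrite -[leRHS]invrK lef_pV2 ?posrE ?invr_gt0.
pose k := e * s.
have k0 : 0 < k by rewrite mulr_gt0.
(* The initial variance in [cE_Phi] is s^2 (1 + l): e^2 comes from the smoothing and 1/(2 N) from
   the rescaling by n/N. *)
pose l := e ^+ 2 + (2 * N%:R)^-1.
have l01 : 0 <= l <= 1.
  rewrite /l invfM; have : 0 < N%:R^-1 :> R by rewrite invr_gt0.
  by move=> ?; apply/andP; split; lra.
have l2 : 80 * l <= eta / 10.
  rewrite /l invfM; rewrite /d in e30; lra.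
have sq c : c / Num.sqrt (k ^+ 2 + N.+1%:R * (2 * N%:R + 1) / (24 * N%:R)) =
            c / s / Num.sqrt (1 + l).
  rewrite -[RHS]mulrA -invfM; congr (_ / _).
  rewrite -[s in RHS]ger0_norm ?(ltW s0)// -sqrtr_sqr -sqrtrM ?sqr_ge0//.
  rewrite s2 /k exprMn s2 /l; congr Num.sqrt.
  by field; rewrite gt_eqF.
have main u : `|u| = d ->
    `|cE N (fun y => Phi ((x * s + u * s - y) / k)) - Phi x| <= eta * 3 / 4 - eta / 4.
  move=> ud; have := @cE_Phi R N k (x * s + u * s) N1 k0.
  rewrite sq -mulrDl mulfK ?gt_eqF// => H1.
  have H2 := Phi_shift_dilate_le x u l01; rewrite ud in H2.
  have H3 : N%:R * (17 / k ^+ 3 + 68 / k ^+ 4 + 17 / (N%:R * k ^+ 2)) <= eta / 4.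
    apply: smoothing_error => //; first by rewrite divr_gt0.
      by lra.
    by rewrite -/A; lra.
  have {}H1 := le_trans H1 H3.
  rewrite -[_ - _](subrKA (Phi ((x + u) / Num.sqrt (1 + l)))).
  apply: le_trans (ler_normD _ _) _.
  by rewrite /d in H2; lra.
have dek : d / e = d * s / k by rewrite /k; field; rewrite !gt_eqF.
(* Where y <= x s the argument of [Phi] is at least d/e >= z, so its value is at least 1 - eta/4;
   the lower bound is symmetric. *)
have up : cE N (fun y => (y <= x * s)%R%:R) <=
    1 * cE N (fun y => Phi ((x * s + d * s - y) / k)) + cE N (fun=> eta / 4).
  rewrite -cE_lin; apply: cE_le => y _; rewrite mul1r.
  have [yx|yx] := leP y (x * s); last by rewrite addr_ge0 ?Phi_ge0// divr_ge0// ltW.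
  rewrite -lerBlDr (le_trans zP)// Phi_nondecreasing// (le_trans ez)//.
  by rewrite dek; apply: ler_wpM2r; [rewrite invr_ge0 ltW|lra].
have lo : 1 * cE N (fun y => Phi ((x * s + (- d) * s - y) / k)) + cE N (fun=> - (eta / 4))
    <= cE N (fun y => (y <= x * s)%R%:R).
  rewrite -cE_lin; apply: cE_le => y _; rewrite mul1r.
  have [yx|yx] := leP y (x * s).
    by rewrite (le_trans _ (Phi_le1 ((x * s + - d * s - y) / k)))// gerBl divr_ge0// ltW.
  rewrite subr_le0 (le_trans _ zN)// Phi_nondecreasing//.
  rewrite lerNr (le_trans ez)// -mulNr.
  by rewrite dek; apply: ler_wpM2r; [rewrite invr_ge0 ltW|lra].
have M1 := main d (gtr0_norm d0).
have M2 : `|cE N (fun y => Phi ((x * s + (- d) * s - y) / k)) - Phi x| <=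
    eta * 3 / 4 - eta / 4 by apply: main; rewrite normrN gtr0_norm.
move: M1 M2 up lo; rewrite !ler_norml !cE_const => /andP[? ?] /andP[? ?] ? ?.
by apply/andP; split; lra.
Qed.

End Kolmogorov.

(** * The four classes *)

Section SignedSumEstimates.
Variable R : realType.
Implicit Types (g : nat -> R).

Lemma eq_signed_sum b1 b2 n g g' : g =1 g' ->
  signed_sum b1 b2 n g = signed_sum b1 b2 n g'.
Proof. by move=> E; apply: eq_bigr => w _; rewrite E. Qed.

Lemma signed_sum_eq0 b1 b2 n g : g =1 (fun=> 0) -> signed_sum b1 b2 n g = 0.
Proof. by move=> g0; rewrite /signed_sum big1// => w _; rewrite g0 mulr0. Qed.

Lemma signed_sum_eulB n g :
  signed_sum false false n g = (2 ^ n * n`!)%N%:R * eulB n g.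
Proof.
elim: n g => [|n IH] g.
  by rewrite /signed_sum big_seq1 /= !expr0 !mul1r.
rewrite signed_sum_eulerian IH /=.
set g' := fun d => _.
have <- : (2 * n.+1%:R)^-1 * eulB n g' + eulB n (fun=> 0) =
    eulB n (fun d => ((2 * d%:R + 1) * g d + (2 * n%:R + 1 - 2 * d%:R) * g d.+1)
                     / (2 * n.+1%:R)).
  by rewrite -eulB_lin; apply: eq_eulB => d _; rewrite addr0 mulrC.
rewrite eulB_const addr0 expnS factS !natrM; field.
by rewrite nat1r.
Qed.

Let twice_le (x y M : R) : `|x| <= M -> `|y| <= M -> `|x - y| <= 2 * M.
Proof. by move=> xM yM; apply: le_trans (ler_normB _ _) _; lra. Qed.

(** A first difference at most doubles the bound for each letter, a second difference multiplies it
    by at most 4 for two letters. *)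
Lemma signed_sum_bound b1 b2 n g (M : R) : b1 || b2 -> (forall d, `|g d| <= M) ->
  `|signed_sum b1 b2 n g| <= 2 ^+ n * M.
Proof.
case: b1 => /= [_|].
  elim: n g M => [|n IH] g M gM.
    by rewrite /signed_sum big_seq1 /= andbF !expr0 !mul1r gM.
  rewrite signed_sum_negs exprSr -mulrA; apply: IH => d; exact: twice_le.
case: b2 => // _.
elim/ltn_ind: n g M => -[|[|n]] IH g M gM.
- by rewrite /signed_sum big_seq1 /= !expr0 !mul1r gM.
- rewrite /signed_sum signed_big big_seq1 big_ord1 /= !expr0 !mul1r expr1.
  by apply: le_trans (ler_normD _ _) _; rewrite mulr2n mulrDl mul1r lerD.
rewrite signed_sum_inv.
rewrite (_ : 2 ^+ n.+2 * M = 2 ^+ n * (4 * M)); last by rewrite !exprSr; ring.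
apply: IH => // d; have := gM d; have := gM d.+1; have := gM d.+2.
rewrite !ler_norml => /andP[? ?] /andP[? ?] /andP[? ?]; apply/andP; split; lra.
Qed.

(** Removing two letters takes two first differences or one second difference, which annihilates
    affine functions. *)
Lemma signed_sum_affine b1 b2 n (a b : R) : b1 || b2 -> (3 <= n)%N ->
  signed_sum b1 b2 n (fun d => a + b * d%:R) = 0.
Proof.
case: b1 b2 => -[] // _; case: n => [|[|n]] // n3;
  rewrite ?signed_sum_negs ?signed_sum_inv; apply: signed_sum_eq0 => d; rewrite -!natr1; ring.
Qed.

(** Removing four letters takes four first differences or two second ones. *)
Lemma signed_sum_quadratic b1 b2 n (a b c : R) : b1 || b2 -> (4 <= n)%N ->
  signed_sum b1 b2 n (fun d => a + b * d%:R + c * d%:R ^+ 2) = 0.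
Proof.
case: b1 b2 => -[] // _; case: n => [|[|[|[|n]]]] // n3;
  rewrite ?signed_sum_negs ?signed_sum_inv; apply: signed_sum_eq0 => d; rewrite -!natr1; ring.
Qed.

Definition class_sum (e s : bool) n g : R :=
  \sum_(w <- swords n | (odd (negsw w) == e) && (odd (invw w) == s)) g (desw 0 w).

(** Expansion of (1 + (-1)^(e + negs)) (1 + (-1)^(s + invD)), which is 4 times the indicator of the
    class. *)
Lemma class_sumE e s n g : 4 * class_sum e s n g =
  signed_sum false false n g + (-1) ^+ e * signed_sum true false n g
  + (-1) ^+ s * signed_sum false true n g
  + (-1) ^+ e * (-1) ^+ s * signed_sum true true n g.
Proof.
rewrite /class_sum /signed_sum big_mkcond !mulr_sumr -!big_split.
apply: eq_bigr => w _ /=.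
by case: e s => -[]; case: (odd (negsw w)); case: (odd (invw w));
  rewrite /= ?expr0 ?expr1; ring.
Qed.

Lemma class_sum_exact e s n g :
  (forall b1 b2, b1 || b2 -> signed_sum b1 b2 n g = 0) ->
  4 * class_sum e s n g = (2 ^ n * n`!)%N%:R * eulB n g.
Proof.
move=> g0; rewrite class_sumE (g0 true false isT) (g0 false true isT).
by rewrite (g0 true true isT) !mulr0 !addr0 signed_sum_eulB.
Qed.

Let pow_fact_gt0 n : 0 < (2 ^ n * n`!)%N%:R :> R.
Proof. by rewrite ltr0n muln_gt0 expn_gt0 fact_gt0. Qed.

Lemma class_sum1 e s n : (3 <= n)%N ->
  4 * class_sum e s n (fun=> 1) = (2 ^ n * n`!)%N%:R.
Proof.
move=> n3; rewrite class_sum_exact ?eulB_const ?mulr1// => b1 b2 b12.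
rewrite -[RHS](signed_sum_affine 1 0 b12 n3).
by apply: eq_signed_sum => d; rewrite mul0r addr0.
Qed.

Lemma class_ratio_exact e s n g : (3 <= n)%N ->
  (forall b1 b2, b1 || b2 -> signed_sum b1 b2 n g = 0) ->
  class_sum e s n g / class_sum e s n (fun=> 1) = eulB n g.
Proof.
move=> n3 /(class_sum_exact e s) E; have E1 := class_sum1 e s n3.
have K0 := pow_fact_gt0 n.
move: E E1 K0; set K := (2 ^ n * n`!)%N%:R => E E1 K0; clearbody K.
have -> : class_sum e s n g = K * eulB n g / 4 by rewrite -E; field.
have -> : class_sum e s n (fun=> 1) = K / 4 by rewrite -E1; field.
by field; rewrite gt_eqF.
Qed.

(** The three nontrivial signed sums are together at most 3 * 2^n, against the total 2^n n!, and n
    <= n!. *)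
Lemma class_ratio_approx e s n g : (3 <= n)%N -> (forall d, `|g d| <= 1) ->
  `|class_sum e s n g / class_sum e s n (fun=> 1) - eulB n g| <= 3 / n%:R.
Proof.
move=> n3 g1; have E1 := class_sum1 e s n3; have K0 := pow_fact_gt0 n.
have E := class_sumE e s n g; rewrite signed_sum_eulB -!addrA in E.
have B b1 b2 := @signed_sum_bound b1 b2 n g 1 ^~ g1.
move: E; set r := (-1) ^+ e * _ + _ => E.
have rle : `|r| <= 3 * 2 ^+ n.
  have := B true false isT; have := B false true isT; have := B true true isT.
  rewrite !mulr1 => b1 b2 b3.
  have sg (c : bool) (x : R) : `|(-1) ^+ c * x| = `|x|.
    by rewrite normrM normrX normrN1 expr1n mul1r.
  apply: le_trans (ler_normD _ _) _; rewrite sg.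
  have := ler_normD ((-1) ^+ s * signed_sum false true n g)
                   ((-1) ^+ e * (-1) ^+ s * signed_sum true true n g).
  rewrite -mulrA !sg; lra.
have -> : class_sum e s n g / class_sum e s n (fun=> 1) - eulB n g =
    r / (2 ^ n * n`!)%N%:R.
  move: E E1 K0; set K := (2 ^ n * n`!)%N%:R => E E1 K0; clearbody K.
  have -> : class_sum e s n g = (K * eulB n g + r) / 4 by rewrite -E; field.
  have -> : class_sum e s n (fun=> 1) = K / 4 by rewrite -E1; field.
  by field; rewrite gt_eqF.
rewrite normrM normfV (gtr0_norm K0) ler_pdivrMr//; apply: (le_trans rle).
have n0 : 0 < n%:R :> R by rewrite ltr0n; lia.
rewrite mulrAC ler_pdivlMr// -mulrA ler_wpM2l// natrM natrX ler_wpM2l ?exprn_ge0//.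
by rewrite ler_nat fact_geq.
Qed.

End SignedSumEstimates.

(** * Coefficients of a generating polynomial as the law of a statistic *)

Section CoefficientLaw.
Variables (R : realType) (T : finType) (A : {set T}) (f : T -> nat).

Let P : {poly R} := \sum_(p in A) 'X^(f p).

Lemma coef_monomial_sum k : P`_k = \sum_(p in A) (k == f p)%:R.
Proof. by rewrite coef_sum; apply: eq_bigr => p _; rewrite coefXn. Qed.

Lemma horner_monomial_sum : P.[1] = #|A|%:R.
Proof.
rewrite horner_sum -sum1_card natr_sum; apply: eq_bigr => p _.
by rewrite hornerXn expr1n.
Qed.

Lemma size_monomial_sum p : p \in A -> (f p < size P)%N.
Proof.
move=> pA; rewrite ltnNge; apply/negP => /leq_sizeP/(_ _ (leqnn _))/eqP.
rewrite coef_monomial_sum psumr_eq0 => [/allP/(_ p (mem_index_enum p))|q _] //.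
by rewrite pA eqxx /= oner_eq0.
Qed.

(** Exchanging the sums shows that the coefficient law is that of [f] under the uniform distribution
    on [A]; mean, variance and distribution function are instances. *)
Lemma sum_coef_prob (h : nat -> R) :
  \sum_(k < size P) h k * coef_prob P k = (\sum_(p in A) h (f p)) / #|A|%:R.
Proof.
rewrite /coef_prob horner_monomial_sum mulr_suml.
under eq_bigr => k _ do rewrite coef_monomial_sum mulr_suml mulr_sumr.
rewrite exchange_big; apply: eq_bigr => p pA /=.
rewrite (bigD1 (Ordinal (size_monomial_sum pA)))//= eqxx mul1r big1 ?addr0// => k kp.
by rewrite (_ : (_ == _) = false) ?mul0r ?mulr0//; apply/negbTE.
Qed.

Lemma coef_meanE : coef_mean P = unif_mean A (fun p => (f p)%:R).
Proof. exact: sum_coef_prob. Qed.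

Lemma coef_varE : coef_var P = unif_var A (fun p => (f p)%:R).
Proof.
by rewrite /coef_var coef_meanE (sum_coef_prob (fun k => (k%:R - _) ^+ 2)).
Qed.

Lemma coef_cdfE y :
  coef_cdf P y = (\sum_(p in A) ((f p)%:R <= y)%R%:R) / #|A|%:R.
Proof.
rewrite -(sum_coef_prob (fun k => (k%:R <= y)%R%:R)) /coef_cdf big_mkcond.
apply: eq_bigr => k _; rewrite floor_ge_int /=.
by case: ifP; rewrite ?mul1r ?mul0r.
Qed.

End CoefficientLaw.

(** * Mean, variance and asymptotic normality in one class *)

Section Classes.
Variables (R : realType) (e s : bool) (A : forall n, {set {perm letter n}}).
Hypothesis sumA : forall n (g : nat -> R),
  \sum_(p in A n) g (desB p) = class_sum e s n g.

Let cardA n : #|A n|%:R = class_sum e s n (fun=> 1) :> R.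
Proof. by rewrite -sumA sumr_const. Qed.

Lemma class_mean n : (3 <= n)%N ->
  unif_mean (A n) (fun p => (desB p)%:R : R) = n%:R / 2%:R.
Proof.
move=> n3; rewrite /unif_mean (sumA _ (fun d => d%:R)) cardA class_ratio_exact//.
  have := cE_mean R n; rewrite /cE /=.
  have -> : eulB n (fun d => d%:R - n%:R / 2 : R) =
            1 * eulB n (fun d => d%:R) + eulB n (fun=> - (n%:R / 2)).
    by rewrite -eulB_lin; apply: eq_eulB => d _; rewrite mul1r.
  by rewrite eulB_const mul1r => /eqP; rewrite subr_eq0 => /eqP.
move=> b1 b2 b12; rewrite -[RHS](signed_sum_affine 0 1 b12 n3).
by apply: eq_signed_sum => d; rewrite add0r mul1r.
Qed.

Lemma class_var n : (4 <= n)%N ->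
  unif_var (A n) (fun p => (desB p)%:R : R) = n.+1%:R / 12%:R.
Proof.
move=> n4; rewrite /unif_var class_mean ?(ltnW n4)// /unif_mean.
rewrite (sumA _ (fun d => (d%:R - n%:R / 2) ^+ 2)) cardA class_ratio_exact ?(ltnW n4)//.
  by apply: cE_sqr; lia.
move=> b1 b2 b12.
rewrite -[RHS](signed_sum_quadratic ((n%:R / 2) ^+ 2) (- n%:R) 1 b12 n4).
by apply: eq_signed_sum => d; field.
Qed.

Local Open Scope classical_set_scope.
Local Open Scope ring_scope.

Lemma class_normal :
  asymptotically_normal (fun n => \sum_(p in A n) 'X^(desB p) : {poly R}).
Proof.
pose P n : {poly R} := \sum_(p in A n) 'X^(desB p).
pose D n x := `|coef_cdf (P n) (x * coef_sd (P n) + coef_mean (P n)) - Phi x|.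
have small (eta : R) : 0 < eta ->
    \forall n \near \oo, forall x, D n x <= eta.
  move=> eta0; have [N0 H] := @cE_clt R (eta / 2) (divr_gt0 eta0 (ltr0n _ 2)).
  (* From 4 on the mean and the variance are exact, and n >= 6/eta makes the error 3/n of
     [class_ratio_approx] at most eta/2. *)
  exists (maxn 4 (maxn N0 (Num.truncn (6 / eta)).+1)) => // n /=.
  rewrite !geq_max => /and3P[n4 nN nE] x; rewrite /D /P.
  have n0 : 0 < n%:R :> R by rewrite ltr0n; lia.
  have {}nE : 3 / n%:R <= eta / 2.
    rewrite ler_pdivrMr//; suff : 6 / eta <= n%:R by rewrite ler_pdivrMr//; lra.
    by apply: le_trans (ltW (truncnS_gt _)) _; rewrite ler_nat; exact: nE.
  rewrite /coef_sd coef_varE class_var// coef_meanE class_mean ?(ltnW n4)// coef_cdfE.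
  set c := x * _.
  rewrite (sumA _ (fun d => (d%:R <= c + n%:R / 2)%R%:R)) cardA.
  have g1 (d : nat) : `|(d%:R <= c + n%:R / 2)%R%:R : R| <= 1.
    by case: (d%:R <= _); rewrite ?normr1 ?normr0.
  have := class_ratio_approx e s (ltnW n4) g1.
  have := H n nN x; rewrite /cE -/c.
  have -> : eulB n (fun d => (d%:R - n%:R / 2 <= c)%R%:R) =
            eulB n (fun d => (d%:R <= c + n%:R / 2)%R%:R) :> R.
    by apply: eq_eulB => d _; rewrite lerBlDr.
  set E := eulB _ _; set r := _ / _ => H1 H2.
  rewrite -[_ - _](subrKA E); apply: le_trans (ler_normD _ _) _; lra.
have sup_ge0 n : (0 <= ereal_sup (range (fun x => (D n x)%:E)))%E.
  apply: (@le_trans _ _ (D n 0)%:E); first by rewrite lee_fin normr_ge0.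
  by apply: ereal_sup_ubound; exists 0.
have sup_le eta : 0 < eta -> \forall n \near \oo,
    (ereal_sup (range (fun x => (D n x)%:E)) <= eta%:E)%E.
  move=> /small; apply: filterS => n Dn.
  by apply: ge_ereal_sup => _ [x _ <-]; rewrite lee_fin.
(* The suprema are eventually at most 1, hence finite, and the limit can be taken in the reals. *)
apply/fine_cvgP; split.
  have := sup_le 1 ltr01; apply: filterS => n n1.
  by rewrite fin_numElt (lt_le_trans _ (sup_ge0 n)) ?ltNy0//= (le_lt_trans n1) ?ltry.
apply/cvgrPdist_le => eta eta0; have := sup_le eta eta0; apply: filterS => n n1.
rewrite sub0r normrN /= ger0_norm; last by apply: fine_ge0; exact: sup_ge0.
have fn : ereal_sup (range (fun x => (D n x)%:E)) \is a fin_num.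
  by rewrite fin_numElt (lt_le_trans _ (sup_ge0 n)) ?ltNy0//= (le_lt_trans n1) ?ltry.
by rewrite -lee_fin fineK.
Qed.

End Classes.

Lemma sum_Dpm (R : realType) (s : bool) n (g : nat -> R) :
  \sum_(p in Dpm n s) g (desB p) = class_sum false s n g.
Proof.
rewrite /class_sum -(big_signed_perms n (fun w => g (desw 0 w))).
apply: eq_big => [p|p _]; last by rewrite desB_word.
by rewrite !inE -negs_word -invD_word eqbF_neg andbA.
Qed.

Lemma sum_BDpm (R : realType) (s : bool) n (g : nat -> R) :
  \sum_(p in BDpm n s) g (desB p) = class_sum true s n g.
Proof.
rewrite /class_sum -(big_signed_perms n (fun w => g (desw 0 w))).
apply: eq_big => [p|p _]; last by rewrite desB_word.
rewrite !inE -negs_word -invD_word eqb_id.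
by case: [forall x, _]; case: (odd (negs p)).
Qed.

Theorem theorem5p14 (R : realType) (s : bool) :
  [/\ asymptotically_normal (BDesD R s),
      asymptotically_normal (BDesBD R s),
      (forall n : nat, (3 <= n)%N ->
         unif_mean (Dpm n s) (fun p => (desB p)%:R : R) = n%:R / 2%:R)
      /\ (forall n : nat, (4 <= n)%N ->
         unif_var (Dpm n s) (fun p => (desB p)%:R : R) = n.+1%:R / 12%:R)
    & (forall n : nat, (3 <= n)%N ->
         unif_mean (BDpm n s) (fun p => (desB p)%:R : R) = n%:R / 2%:R)
      /\ (forall n : nat, (4 <= n)%N ->
         unif_var (BDpm n s) (fun p => (desB p)%:R : R) = n.+1%:R / 12%:R)].
Proof.
have sD := @sum_Dpm R s; have sB := @sum_BDpm R s.
split; [exact: class_normal sD | exact: class_normal sB | split | split].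
- exact: class_mean sD.
- exact: class_var sD.
- exact: class_mean sB.
- exact: class_var sB.
Qed.
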